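(* Let $n\ge2$, let $\Sigma\subset\mathbb{R}^n$ be a $C^2$ hypersurface and $\varepsilon>0$. Then for every $R\ge C_{\Sigma,\varepsilon}$ there is a $C^2$ hypersurface $\Sigma'_R$ within $\varepsilon$ of $\Sigma$ in the $C^2$ topology which contains at least $c_{\Sigma,\varepsilon}R^{n-2+\frac{2}{n+1}}$ points of the lattice $(\tfrac1R\mathbb{Z})^n$, where $C_{\Sigma,\varepsilon},c_{\Sigma,\varepsilon}>0$ depend only on $\Sigma,\varepsilon$ (and $n$). *)

(* Defs.v *)
From HB Require Import structures.
From mathcomp Require Import all_boot all_order all_algebra.
From mathcomp Require Import all_classical all_reals all_analysis.
Set Implicit Arguments. Unset Strict Implicit. Unset Printing Implicit Defensive.
Import Order.TTheory GRing.Theory Num.Theory.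
Import numFieldNormedType.Exports.
Local Open Scope classical_set_scope.
Local Open Scope ring_scope.

Definition evec (R : realType) (n : nat) (i : 'I_n) : 'rV[R]_n := delta_mx 0 i.

Definition partial (R : realType) (n : nat) (V : normedModType R)
  (i : 'I_n) (f : 'rV[R]_n -> V) : 'rV[R]_n -> V :=
  fun x => derive f x (evec R i).

Definition C1 (R : realType) (n : nat) (V : normedModType R)
  (f : 'rV[R]_n -> V) : Prop :=
  forall i : 'I_n,
    (forall x, derivable f x (evec R i)) /\ continuous (partial i f).

Definition C2 (R : realType) (n : nat) (V : normedModType R)
  (f : 'rV[R]_n -> V) : Prop :=
  C1 f /\ forall i : 'I_n, C1 (partial i f).

Definition C2_hypersurface (R : realType) (n : nat) (S : set 'rV[R]_n) : Prop :=
  forall p, S p ->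
    exists (U : set 'rV[R]_n) (F : 'rV[R]_n -> R),
      [/\ open U, U p, C2 F,
          (forall x, U x -> S x -> exists i : 'I_n, partial i F x != 0)
        & U `&` S = U `&` (F @^-1` [set 0])].

Definition C2_close (R : realType) (n : nat) (eps : R)
  (S S' : set 'rV[R]_n) : Prop :=
  exists (Phi Psi : 'rV[R]_n -> 'rV[R]_n),
    [/\ C2 Phi, C2 Psi, cancel Phi Psi & cancel Psi Phi] /\
    [/\ S' = Phi @` S,
        (forall x, `|Phi x - x| < eps),
        (forall x (i : 'I_n), `|partial i Phi x - evec R i| < eps)
      & (forall x (i j : 'I_n), `|partial j (partial i Phi) x| < eps)].

Definition in_scaled_lattice (R : realType) (n : nat) (rho : R)
  (x : 'rV[R]_n) : Prop :=
  forall i : 'I_n, exists z : int, x 0 i = z%:~R / rho.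

(* Main.v *)
(** Near a point of [S] the surface contains a point over every [x'] in a small
    ball of a coordinate hyperplane; nothing else about this height function is
    used.  Cut the ball into cubes of side [M / rho] with [M ~ rho^(1/(n+1))],
    each holding [M^(n-1)] lattice columns.  Tilting the surface by
    [theta_k sin (x_k - p_k)] and lifting it by [t], a second moment argument
    over [(theta, t)] shows that, for some choice, a positive proportion of the
    cubes have a column where the surface passes within
    [~ 1 / (rho M^(n-1)) ~ (M / rho)^2] of a lattice point.  Adding in each
    such cube a bump of radius [M / rho] and height [<= eps (M / rho)^2], which
    is small in [C^2], makes the surface pass through that point.  All these
    perturbations are shears in one coordinate direction, so their inverses
    are explicit. *)

Require Import Defs.
From HB Require Import structures.
From mathcomp Require Import all_boot all_order all_algebra.
From mathcomp Require Import all_classical all_reals all_analysis.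
From mathcomp Require Import ring lra zify.
Set Implicit Arguments. Unset Strict Implicit. Unset Printing Implicit Defensive.
Import Order.TTheory GRing.Theory Num.Theory.
Import numFieldNormedType.Exports.
Local Open Scope classical_set_scope.
Local Open Scope ring_scope.

(** The obstacle is that the heights over one cube may cluster modulo [1 / rho] around a value that
    changes from cube to cube, and then no common lift serves many cubes. The tilts break such
    clusters: in lattice units, two columns of a cube that differ in coordinate [k] have a height
    difference that moves with [theta k] at a rate between [1 / 2] and [M], so they agree modulo 1
    up to [1 / A] only for a proportion O(1 / A) of the tilts. A sine replaces a linear tilt because
    closeness is demanded uniformly on the whole space, where linear functions are unbounded. The
    scale is a balance: a C^2-small bump of radius [M / rho] can only reach height about
    [(M / rho)^2], and [M^(n-1)] columns leave gaps of about [1 / (rho M^(n-1))], whence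
    [M^(n+1) ~ rho]. The [(rho / M)^(n-1)] cubes then give the exponent n(n-1)/(n+1) = n - 2 +
    2/(n+1). Tilts and lifts run over finite grids, so every probability below is a ratio of
    cardinalities. *)

(** * Second moment counting over finite parameter sets *)

Section Averaging.
Local Open Scope nat_scope.

(** In a fibre with a chosen element [u0], every other element collides with [u0]; [u0] itself is
    paid for by its image. *)
Lemma card_le_imset_collisions (U V : finType) (f : U -> V) :
  #|U| <= #|f @: [set: U]%SET| +
    \sum_u \sum_u' ((u != u') && (f u == f u') : nat).
Proof.
rewrite -cardsT -sum1_card (partition_big_imset f)/= -sum1_card.
rewrite [X in _ <= _ + X](_ : _ = \sum_(v in f @: [set: U]%SET)
    \sum_(u | f u == v) \sum_u' ((u != u') && (f u == f u') : nat)); last first.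
  rewrite (eq_bigl (fun u => u \in [set: U]%SET)); last by move=> u; rewrite finset.in_setT.
  rewrite (partition_big_imset f)/=; apply: eq_bigr => v _.
  by apply: eq_bigl => u; rewrite finset.in_setT.
rewrite -big_split/=; apply: leq_sum => v /imsetP[u0 _ ->].
rewrite (bigD1 u0)/= ?finset.in_setT ?eqxx// leq_add2l.
rewrite [X in _ <= X](bigD1 u0)//=; apply: leq_trans (leq_addr _ _).
rewrite [X in _ <= X](bigID (fun u => (f u == f u0) && (u != u0)))/=.
apply: leq_trans (leq_addr _ _).
rewrite (eq_bigl (fun u => (f u == f u0) && (u != u0))).
  by apply: leq_sum => u /andP[/eqP -> ]; rewrite eq_sym => ->; rewrite eqxx.
by move=> u; rewrite finset.in_setT.
Qed.

(** Collision probability at most 1/(2|U|) leaves on average at most |U|/2 ordered colliding pairs,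
    so [res b j] takes on average at least |U|/2 values. Averaging over [b] and [v] gives one choice
    that serves the stated number of [j]. In the application [b] is a tilt, [j] a cube, [u] a column
    of it and [v] a lift. *)
Lemma exists_frequent_value (Th J U V : finType) (res : Th -> J -> U -> V) :
  0 < #|Th| -> 0 < #|J| -> 0 < #|U| ->
  (forall j u u', u != u' ->
     #|[set b | res b j u == res b j u']%SET| * (2 * #|U|) <= #|Th|) ->
  exists b v, #|J| * #|U| <= 2 * #|V| * #|[set j | [exists u, res b j u == v]]%SET|.
Proof.
move=> Th0 J0 U0 coll; apply: contrapT => Hn.
pose hits b v := #|[set j | [exists u, res b j u == v]]%SET|.
have {}Hn b v : 2 * #|V| * hits b v < #|J| * #|U|.
  by rewrite ltnNge; apply/negP => h; apply: Hn; exists b, v.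
have swap b : \sum_j #|res b j @: [set: U]%SET| = \sum_v hits b v.
  under eq_bigr do rewrite -sum1_card big_mkcond/=.
  rewrite exchange_big/=; apply: eq_bigr => v _.
  rewrite /hits -sum1_card [RHS]big_mkcond/=; apply: eq_bigr => j _.
  rewrite inE; congr (if _ then _ else _); apply/imsetP/existsP.
    by move=> [u _ ->]; exists u.
  by move=> [u /eqP <-]; exists u; rewrite ?finset.in_setT.
have upper : 2 * \sum_b \sum_v hits b v < #|Th| * (#|J| * #|U|).
  have [b0 _] := card_gt0P Th0; have [j0 _] := card_gt0P J0.
  have [u0 _] := card_gt0P U0; have V0 : 0 < #|V| by apply/card_gt0P; exists (res b0 j0 u0).
  rewrite -(ltn_pmul2l V0) mulnA (mulnC #|V|) big_distrr/=.
  apply: (@leq_ltn_trans (\sum_(b : Th) \sum_(v : V) (#|J| * #|U|).-1)).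
    apply: leq_sum => b _; rewrite big_distrr/=; apply: leq_sum => v _.
    by rewrite -ltnS prednK ?muln_gt0 ?J0//; apply: Hn.
  rewrite !sum_nat_const mulnCA ltn_pmul2l// ltn_pmul2l//.
  by rewrite prednK ?muln_gt0 ?J0.
move: upper; rewrite ltnNge => /negP; apply.
pose cl := \sum_b \sum_j \sum_u \sum_u' ((u != u') && (res b j u == res b j u') : nat).
have clB : 2 * cl <= #|Th| * (#|J| * #|U|).
  rewrite -(leq_pmul2r U0) [2 * _]mulnC -mulnA /cl.
  rewrite exchange_big/= big_distrl/=.
  rewrite (_ : _ * _ * _ = \sum_(j : J) \sum_(u : U) \sum_(u' : U) #|Th|); last first.
    by rewrite !sum_nat_const !mulnA [RHS]mulnC !mulnA.
  apply: leq_sum => j _; rewrite exchange_big/= big_distrl/=.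
  apply: leq_sum => u _; rewrite exchange_big/= big_distrl/=.
  apply: leq_sum => u' _; have [//|uu'/=] := eqVneq u u'.
    by rewrite big1.
  apply: leq_trans (coll j u u' uu'); rewrite leq_mul2r; apply/orP; right.
  rewrite -sum1_card [leqRHS]big_mkcond/=; apply: leq_sum => b _.
  by rewrite inE; case: eqP.
have lower : #|Th| * (#|J| * #|U|) <= \sum_b \sum_v hits b v + cl.
  rewrite -big_split/= -sum_nat_const; apply: leq_sum => b _.
  rewrite -swap -big_split/= -sum_nat_const; apply: leq_sum => j _.
  exact: card_le_imset_collisions.
lia.
Qed.
End Averaging.

(** * Near-integer counts for linear forms on a grid of tilts *)

Section Residues.
Variable R : realType.

Lemma card_ord_diam (B : nat) (P : {set 'I_B}) (l : R) : 0 <= l ->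
  (forall b b', b \in P -> b' \in P -> b'%:R - b%:R <= l) -> #|P|%:R <= l + 1.
Proof.
move=> l0 Pl; have [->|/set0Pn[b2 b2P]] := eqVneq P finset.set0.
  by rewrite cards0 ler_wpDl.
have [b0 b0P b0min] := arg_minnP (fun b : 'I_B => b : nat) b2P.
have [b1 b1P b1max] := arg_maxnP (fun b : 'I_B => b : nat) b2P.
pose f (b : 'I_B) : 'I_(b1 - b0).+1 := inord (b - b0).
have finj : {in P &, injective f}.
  move=> b b' bP b'P /(congr1 (@nat_of_ord _)); rewrite /f !inordK.
  - move: (b0min _ bP) (b0min _ b'P) => h h' e; apply: val_inj => /=.
    by rewrite -(subnK h) -(subnK h') e.
  - by rewrite ltnS leq_sub2r//; exact: b1max.
  - by rewrite ltnS leq_sub2r//; exact: b1max.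
have : (#|P| <= (b1 - b0).+1)%N.
  by rewrite -(card_in_imset finj) (leq_trans (max_card _))// card_ord.
rewrite -(ler_nat R) => /le_trans; apply.
by rewrite -natr1 lerD2r natrB ?Pl// b0min.
Qed.

(** Group the progression by the integer it is close to: at most [s * B + 2] integers occur, and the
    [b] close to a given one span a range of length at most [2 * w / s]. *)
Lemma card_near_int_pos (B : nat) (c s w : R) : 0 < s -> 0 <= w <= 2^-1 ->
  #|[set b : 'I_B | `[< exists z : int, `|c + s * b%:R - z%:~R| < w >]]%SET|%:R
    <= (2 * w / s + 1) * (s * B%:R + 2).
Proof.
move=> s0 /andP[w0 w12]; set P := finset _.
pose x (b : 'I_B) := c + s * b%:R.
pose q b := `|Num.floor (x b + w) - Num.floor (c + w)|%N.
have ge b : Num.floor (c + w) <= Num.floor (x b + w).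
  by rewrite le_floor// /x lerD2r lerDl mulr_ge0// ltW.
have qE b : (q b)%:R = (Num.floor (x b + w))%:~R - (Num.floor (c + w))%:~R :> R.
  rewrite -intrB /q -[LHS](_ : (q b : int)%:~R = _)//; congr (_%:~R).
  by rewrite /q gez0_abs// subr_ge0.
pose Q := Num.truncn (s * B%:R + 1).
have sB0 : 0 <= s * B%:R + 1 by rewrite addr_ge0// mulr_ge0// ltW.
have qQ b : (q b < Q.+1)%N.
  rewrite ltnS /Q -(@natrK R (q b)); apply: le_truncn.
  rewrite qE lerBlDr; apply: (le_trans (floor_le _)).
  have h := @floorD1_gt R (c + w); rewrite intrD in h.
  have : s * b%:R <= s * B%:R by rewrite ler_pM2l// ler_nat ltnW.
  rewrite /x; lra.
have near b : b \in P -> `|x b - (Num.floor (x b + w))%:~R| < w.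
  rewrite inE => /asboolP[z]; rewrite -/(x b) => zw.
  (* Because [w <= 1 / 2], the point [x b + w] lies between [z] and [z + 1], so the floor recovers
     the nearby integer. *)
  suff -> : Num.floor (x b + w) = z by [].
  by apply/floor_def; rewrite intrD; move: zw; rewrite ltr_distl => /andP[]; lra.
rewrite -sum1_card (partition_big (fun b => inord (q b) : 'I_Q.+1) xpredT)//=.
rewrite natr_sum; apply: (@le_trans _ _ (\sum_(i < Q.+1) (2 * w / s + 1))).
  apply: ler_sum => i _.
  rewrite (_ : (\sum_(_ | _) _)%N = #|P :&: [set b | inord (q b) == i]|%SET); last first.
    by rewrite -sum1_card; apply: eq_bigl => b; rewrite !inE.
  apply: card_ord_diam; first by rewrite !mulr_ge0// invr_ge0 ltW.
  move=> b b'; rewrite finset.in_setI => /andP[bP]; rewrite inE => /eqP bi.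
  rewrite finset.in_setI => /andP[b'P]; rewrite inE => /eqP b'i.
  have qq : q b = q b' by rewrite -[LHS](@inordK Q)// bi -b'i inordK.
  have ff : (Num.floor (x b + w))%:~R = (Num.floor (x b' + w))%:~R :> R.
    by have := qE b; have := qE b'; rewrite qq => -> /eqP; rewrite (inj_eq (addIr _)) => /eqP.
  move: (near _ bP) (near _ b'P); rewrite ff !ltr_distl /x => /andP[h1 h2] /andP[h3 h4].
  rewrite ler_pdivlMr//; nra.
rewrite sumr_const card_ord -[leLHS]mulr_natr ler_wpM2l//.
  by rewrite addr_ge0// !mulr_ge0// invr_ge0 ltW.
have /andP[+ _] := truncn_itv sB0; rewrite -/Q -natr1; lra.
Qed.

Lemma card_near_int (B : nat) (c s w : R) : s != 0 -> 0 <= w <= 2^-1 ->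
  #|[set b : 'I_B | `[< exists z : int, `|c + s * b%:R - z%:~R| < w >]]%SET|%:R
    <= (2 * w / `|s| + 1) * (`|s| * B%:R + 2).
Proof.
move=> s0 w12; have [sp|sn|/eqP] := ltgtP s 0; last by rewrite (negbTE s0).
  rewrite ltr0_norm//; apply: (le_trans _ (@card_near_int_pos B (- c) (- s) w _ w12)).
    rewrite ler_nat subset_leq_card//; apply/fintype.subsetP => b; rewrite !inE.
    move=> [z zw]; exists (- z).
    rewrite -normrN; congr (`| _ | < w) : zw; rewrite intrN; ring.
  by rewrite oppr_gt0.
by rewrite gtr0_norm//; apply: card_near_int_pos.
Qed.

Definition ffupd (d : nat) (T : Type) (b : {ffun 'I_d -> T}) (k : 'I_d) (x : T) :=
  [ffun i => if i == k then x else b i].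

Lemma sum_card_ffupd (d B : nat) (k : 'I_d) (P : pred {ffun 'I_d -> 'I_B}) :
  (\sum_(b : {ffun 'I_d -> 'I_B}) #|[set x | P (ffupd b k x)]%SET| =
   B * #|[set b | P b]%SET|)%N.
Proof.
under eq_bigr do rewrite -sum1_card.
rewrite -[in RHS]sum1_card.
transitivity (\sum_(x < B) \sum_(b in [set b | P b]%SET) 1)%N; last first.
  by rewrite big_const_ord iter_addn_0 mulnC.
rewrite pair_big_dep/= [RHS]pair_big_dep/=.
pose h (p : {ffun 'I_d -> 'I_B} * 'I_B) := (p.1 k, ffupd p.1 k p.2).
pose h' (p : 'I_B * {ffun 'I_d -> 'I_B}) := (ffupd p.2 k p.1, p.2 k).
rewrite (reindex h')/=.
  by apply: eq_bigl => -[x b]; rewrite !inE/=; congr (P _); apply/ffunP => i;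
    rewrite !ffunE; case: eqP => // ->.
exists h => -[x b] _; rewrite /h /h'/=; congr (_, _); rewrite ?ffunE ?eqxx//;
  by apply/ffunP => i; rewrite !ffunE; case: eqP => // ->.
Qed.

(** With all coordinates of [b] but the [k]-th frozen, the sum is a progression in [b k] of step
    [eta * g k / B]. The bound [M * A <= B] keeps the step below [1 / A], and [|g k| >= 1 / 2] makes
    the progression sweep a length of at least [eta / 2]. *)
Lemma card_near_int_ffun (d B A : nat) (eta M c : R) (g : 'I_d -> R) (k : 'I_d) :
  0 < eta <= 1 -> 2^-1 <= `|g k| <= M -> (2 <= A)%N -> M * A%:R <= B%:R ->
  #|[set b : {ffun 'I_d -> 'I_B} | `[< exists z : int,
     `|c + \sum_i eta * (b i)%:R / B%:R * g i - z%:~R| < A%:R^-1 >]]%SET|%:R * A%:R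
    <= (3 + 12 / eta) * (B ^ d)%:R.
Proof.
move=> /andP[eta0 eta1] /andP[gk1 gkM] A2 MAB.
have A0 : 0 < A%:R :> R by rewrite ltr0n; lia.
have M0 : 0 < M by lra.
have B0 : 0 < B%:R :> R by apply: lt_le_trans MAB; rewrite mulr_gt0.
set P := fun b : {ffun 'I_d -> 'I_B} => `[< exists z : int, _ >].
set G := `|g k| in gk1 gkM *.
have G0 : 0 < G by lra.
have fib b : #|[set x | P (ffupd b k x)]%SET|%:R * A%:R <= (3 + 12 / eta) * B%:R.
  pose c' := c + \sum_(i | i != k) eta * (b i)%:R / B%:R * g i.
  pose s := eta / B%:R * g k.
  have sE : `|s| = eta * G / B%:R.
    by rewrite /s !normrM normfV (gtr0_norm eta0) (gtr0_norm B0) mulrAC.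
  have s0 : s != 0 by rewrite -normr_gt0 sE !mulr_gt0 ?invr_gt0.
  have w12 : 0 <= (A%:R : R)^-1 <= 2^-1.
    by rewrite invr_ge0 ler0n/= lef_pV2 ?posrE// ler_nat.
  apply: (@le_trans _ _ (#|[set x : 'I_B | `[< exists z : int,
      `|c' + s * x%:R - z%:~R| < A%:R^-1 >]]%SET|%:R * A%:R)).
    rewrite ler_pM2r// ler_nat subset_leq_card//; apply/fintype.subsetP => x; rewrite !inE.
    move=> [z zw]; exists z.
    congr (`| _ - _ | < _) : zw; rewrite (bigD1 k)//= ffunE eqxx /c'.
    rewrite (eq_bigr (fun i => eta * (b i)%:R / B%:R * g i)); last first.
      by move=> i ik; rewrite ffunE (negbTE ik).
    rewrite /s; ring.
  apply: (@le_trans _ _ ((2 * A%:R^-1 / `|s| + 1) * (`|s| * B%:R + 2) * A%:R)).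
    by rewrite ler_pM2r//; apply: card_near_int.
  rewrite sE.
  (* The four terms are at most [2 B], [8 B / eta], [B] and [4 B]; the constants 3 and 12 then come
     from [B <= B / eta]. *)
  have -> : (2 * A%:R^-1 / (eta * G / B%:R) + 1) * (eta * G / B%:R * B%:R + 2) * A%:R
     = 2 * B%:R + 4 * B%:R / (eta * G) + A%:R * (eta * G) + 2 * A%:R.
    by field; rewrite !lt0r_neq0.
  have h1 : B%:R / (eta * G) <= 2 * (B%:R / eta).
    rewrite ler_pdivrMr ?mulr_gt0//.
    have -> : 2 * (B%:R / eta) * (eta * G) = B%:R * (2 * G) by field; rewrite lt0r_neq0.
    by rewrite ler_pMr//; lra.
  have h2 : A%:R * (eta * G) <= B%:R.
    apply: le_trans MAB; rewrite mulrC ler_pM2r//.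
    by apply: le_trans gkM; rewrite ger_pMl.
  have h3 : A%:R <= 2 * B%:R :> R.
    have : 2^-1 * A%:R <= M * A%:R by rewrite ler_pM2r//; lra.
    lra.
  have h4 : B%:R <= B%:R / eta by rewrite ler_pdivlMr// ger_pMr.
  have -> : 4 * B%:R / (eta * G) = 4 * (B%:R / (eta * G)) by rewrite mulrA.
  have -> : (3 + 12 / eta) * B%:R = 3 * B%:R + 12 * (B%:R / eta) by ring.
  lra.
have := sum_card_ffupd k P => /(congr1 (fun n => n%:R * A%:R : R)).
rewrite natr_sum mulr_suml natrM => E.
rewrite -(ler_pM2l B0) mulrA -E mulrCA.
apply: le_trans (ler_sum _ (fun b _ => fib b)) _.
by rewrite sumr_const card_ffun !card_ord -[leLHS]mulr_natr mulrA.
Qed.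

(** The circle R/Z is cut into [A.+1] equal arcs, and this is the index of the arc containing [v].
    The successor makes the ordinal type inhabited, as [inord] requires. *)
Definition residue (A : nat) (v : R) : 'I_A.+1 :=
  inord `|(Num.floor (A.+1%:R * v) %% A.+1)%Z|%N.

Lemma residueP (A : nat) (v : R) :
  exists z : int, 0 <= v - (residue A v)%:R / A.+1%:R - z%:~R < A.+1%:R^-1.
Proof.
set V := Num.floor (A.+1%:R * v); exists (V %/ A.+1)%Z.
have A0 : 0 < A.+1%:R :> R by [].
have rE : (residue A v)%:R = (V %% A.+1)%Z%:~R :> R.
  have m0 : 0 <= (V %% A.+1)%Z by rewrite modz_ge0.
  rewrite /residue inordK; last by rewrite -ltz_nat gez0_abs// ltz_pmod.
  by rewrite -[in RHS](gez0_abs m0).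
have VE : V%:~R = (V %/ A.+1)%Z%:~R * A.+1%:R + (residue A v)%:R :> R.
  by rewrite rE {1}(divz_eq V A.+1) intrD intrM.
have -> : v - (residue A v)%:R / A.+1%:R - (V %/ A.+1)%Z%:~R = (A.+1%:R * v - V%:~R) / A.+1%:R.
  by rewrite VE; field; rewrite lt0r_neq0.
have h1 := floor_le (A.+1%:R * v); have h2 := @floorD1_gt R (A.+1%:R * v).
rewrite intrD -/V in h1 h2; apply/andP; split.
  by rewrite divr_ge0// subr_ge0.
by rewrite ltr_pdivrMr// mulVf ?lt0r_neq0// ltrBlDr addrC.
Qed.

Lemma residue_eq_near_int (A : nat) (v v' : R) : residue A v = residue A v' ->
  exists z : int, `|v - v' - z%:~R| < A.+1%:R^-1.
Proof.
move=> e; have [z /andP[z1 z2]] := residueP A v; have [z' /andP[z3 z4]] := residueP A v'.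
exists (z - z'); rewrite intrB; rewrite e in z1 z2; rewrite ltr_distl.
set a := A.+1%:R^-1 in z2 z4 *; set b := _ / _ in z1 z2 z3 z4.
by apply/andP; split; lra.
Qed.
End Residues.

(** * Directional derivatives along lines and sheared paths *)

Section DirectionalCalculus.
Variable R : realType.

Lemma is_derive_line (U V : normedModType R) (f : U -> V) (x v : U) (s : R) :
  derivable f (x + s *: v) v ->
  is_derive s (1 : R) (fun t : R => f (x + t *: v)) ('D_v f (x + s *: v)).
Proof.
pose g t := f (x + t *: v).
have E : (fun h => h^-1 *: ((g \o shift s) (h *: 1) - g s)) =
    (fun h => h^-1 *: ((f \o shift (x + s *: v)) (h *: v) - f (x + s *: v))).
  apply/funext => h; rewrite /g/= scalerDl; congr (_ *: (f _ - _)).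
  by rewrite addrCA; congr (_ + _); rewrite /GRing.scale/= mulr1.
by move=> df; apply: DeriveDef; rewrite /derivable /derive E.
Qed.

Lemma is_derive_at0 (U V : normedModType R) (f : U -> V) (x v : U) (df : V) :
  is_derive (0 : R) (1 : R) (fun t : R => f (t *: v + x)) df <-> is_derive x v f df.
Proof.
pose g t := f (t *: v + x).
have E : (fun h => h^-1 *: ((g \o shift 0) (h *: 1) - g 0)) =
    (fun h => h^-1 *: ((f \o shift x) (h *: v) - f x)).
  apply/funext => h; rewrite /g/= scale0r add0r addr0; congr (_ *: (f (_ *: _ + _) - _)).
  by rewrite /GRing.scale/= mulr1.
by split=> -[h1 h2]; apply: DeriveDef; move: h1 h2; rewrite /derivable /derive E.
Qed.

Lemma is_derive_comp1 (U : normedModType R) (g : R -> R) (f : U -> R) (x v : U) (dg df : R) :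
  is_derive (f x) (1 : R) g dg -> is_derive x v f df ->
  is_derive x v (fun y => g (f y)) (dg * df).
Proof.
move=> Hg /is_derive_at0 Hf; apply/is_derive_at0.
have := @is_derive1_comp R g (fun t => f (t *: v + x)) 0 dg df.
by rewrite scale0r add0r; apply.
Qed.

Lemma is_derive_mul (U : normedModType R) (f g : U -> R) (x v : U) (df dg : R) :
  is_derive x v f df -> is_derive x v g dg ->
  is_derive x v (fun y => f y * g y) (f x * dg + g x * df).
Proof. by move=> Hf Hg; apply: is_deriveM. Qed.

Lemma is_derive_add (U V : normedModType R) (f g : U -> V) (x v : U) (df dg : V) :
  is_derive x v f df -> is_derive x v g dg ->
  is_derive x v (fun y => f y + g y) (df + dg).
Proof. by move=> Hf Hg; apply: is_deriveD. Qed.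

Lemma is_derive_mull (U : normedModType R) (f : U -> R) (c : R) (x v : U) (df : R) :
  is_derive x v f df -> is_derive x v (fun y => c * f y) (c * df).
Proof. by move=> Hf; apply: is_deriveZ. Qed.

Lemma is_derive_affine (U V : normedModType R) (g : U -> R) (a w : V) (x v : U) (dg : R) :
  is_derive x v g dg -> is_derive x v (fun y => a + g y *: w) (dg *: w).
Proof.
move=> [Hg Eg].
have E : (fun h => h^-1 *: (((fun y => a + g y *: w) \o shift x) (h *: v) - (a + g x *: w))) =
   (fun h => (h^-1 *: ((g \o shift x) (h *: v) - g x)) *: w).
  apply/funext => h /=.
  by rewrite opprD addrACA subrr add0r -scalerBl scalerA.
have L : (fun h => h^-1 *: (((fun y => a + g y *: w) \o shift x) (h *: v) - (a + g x *: w)))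
    @ 0^' --> dg *: w.
  by rewrite E; apply: cvgZ; [rewrite -Eg; exact: Hg|exact: cvg_cst].
by apply: DeriveDef; [apply/cvg_ex; exists (dg *: w)|apply/cvg_lim].
Qed.

Lemma MVT_line (U : normedModType R) (f : U -> R) (x v : U) (a : R) :
  (forall y, derivable f y v) ->
  exists2 t : R, `|t| <= `|a| & f (x + a *: v) - f x = a * 'D_v f (x + t *: v).
Proof.
move=> df.
have H (b c y : R) : y \in `]b, c[ ->
    is_derive y (1 : R) (fun t : R => f (x + t *: v)) ('D_v f (x + y *: v)).
  by move=> _; apply: is_derive_line.
have C (b c : R) : {within `[b, c], continuous (fun t : R => f (x + t *: v))}.
  apply: derivable_within_continuous => y _.
  by have := @is_derive_line _ _ f x v y (df _) => -[].
have [a0|a0] := leP 0 a.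
  have [t] := MVT_segment a0 (H 0 a) (C 0 a).
  rewrite in_itv/= => /andP[t0 ta]; rewrite scale0r addr0 subr0 mulrC => E.
  by exists t => //; rewrite !ger0_norm.
have [t] := MVT_segment (ltW a0) (H a 0) (C a 0).
rewrite in_itv/= => /andP[t0 ta]; rewrite scale0r addr0 sub0r => E.
exists t; first by rewrite ler0_norm// ltr0_norm// lerN2.
by rewrite -[LHS]opprB E mulrN opprK mulrC.
Qed.

(* The increment of [f] along the sheared path splits into an increment along
   [e], handled by the mean value theorem, and one along [v]. *)
Lemma is_derive_shear_path (U : normedModType R) (f g : U -> R) (e x v : U) (dg : R) :
  let P := fun y => y + g y *: e in
  (forall y, derivable f y e) -> {for P x, continuous ('D_e f)} ->
  derivable f (P x) v -> is_derive x v g dg -> {for x, continuous g} ->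
  is_derive x v (fun y => f (P y)) ('D_v f (P x) + dg * 'D_e f (P x)).
Proof.
move=> P fe Cfe fv [Hg Eg] Cg.
pose dl (h : R) : R := g (h *: v + x) - g x.
have /choice[t tP] (h : R) : exists t : R, `|t| <= `|dl h| /\
    f (h *: v + x + g x *: e + dl h *: e) - f (h *: v + x + g x *: e) =
    dl h * 'D_e f (h *: v + x + g x *: e + t *: e).
  by have [t] := MVT_line (h *: v + x + g x *: e) (dl h) fe; exists t.
have E : (fun h : R => h^-1 *: (((fun y => f (P y)) \o shift x) (h *: v) - f (P x))) =
  (fun h => h^-1 *: ((f \o shift (P x)) (h *: v) - f (P x)) +
     (h^-1 *: ((g \o shift x) (h *: v) - g x)) *
       'D_e f (h *: v + x + g x *: e + t h *: e)).
  apply/funext => h /=.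
  have -> : f (P (h *: v + x)) - f (P x) = (f (h *: v + P x) - f (P x)) +
     dl h * 'D_e f (h *: v + x + g x *: e + t h *: e).
    have [_ <-] := tP h.
    have -> : h *: v + x + g x *: e + dl h *: e = P (h *: v + x).
      by rewrite /P -addrA -scalerDl /dl (addrC (g x)) subrK.
    by rewrite -[h *: v + x + g x *: e]addrA -/(P x) [RHS]addrC addrA subrK.
  by rewrite scalerDr; congr (_ + _); rewrite /GRing.scale/= mulrA.
have shift0 : (fun h : R => h *: v + x) @ (0 : R)^' --> x.
  rewrite -[X in _ --> X]add0r -(scale0r v); apply: cvgD; last exact: cvg_cst.
  apply: cvgZ; last exact: cvg_cst.
  by apply: cvg_within_filter; exact: cvg_id.
have dl0 : dl h @[h --> (0 : R)^'] --> (0 : R).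
  rewrite -[X in _ --> X](subrr (g x)); apply: cvgB; last exact: cvg_cst.
  exact: (cvg_comp _ _ shift0 Cg).
have t0 : t h @[h --> (0 : R)^'] --> (0 : R).
  apply/cvgr0Pnorm_lt => eps eps0; have /cvgr0Pnorm_lt/(_ _ eps0) := dl0.
  by apply: filterS => h; apply: le_lt_trans; have [] := tP h.
have path0 : (fun h : R => h *: v + x + g x *: e + t h *: e) @ (0 : R)^' --> P x.
  rewrite -[P x]addr0 -(scale0r e); apply: cvgD.
    by apply: cvgD => //; exact: cvg_cst.
  by apply: cvgZ => //; exact: cvg_cst.
have L : (fun h : R => h^-1 *: (((fun y => f (P y)) \o shift x) (h *: v) - f (P x)))
    @ 0^' --> 'D_v f (P x) + dg * 'D_e f (P x).
  rewrite E; apply: cvgD; first exact: fv.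
  apply: cvgM; first by rewrite -Eg; exact: Hg.
  exact: (cvg_comp _ _ path0 Cfe).
by apply: DeriveDef; [apply/cvg_ex; exists ('D_v f (P x) + dg * 'D_e f (P x))|apply/cvg_lim].
Qed.

Lemma is_derive_seq_sum (U V : normedModType R) (I : Type) (s : seq I) (P : pred I)
    (f : I -> U -> V) (df : I -> V) (x v : U) :
  (forall i, is_derive x v (f i) (df i)) ->
  is_derive x v (fun y => \sum_(i <- s | P i) f i y) (\sum_(i <- s | P i) df i).
Proof.
move=> H; elim: s => [|i s IH].
  under eq_fun do rewrite big_nil.
  by rewrite big_nil; apply: is_derive_cst.
under eq_fun do rewrite big_cons.
by rewrite big_cons; case: (P i) => //; apply: is_derive_add.
Qed.

Lemma continuous_seq_sum (U : topologicalType) (V : normedModType R) (I : Type) (s : seq I)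
    (P : pred I) (f : I -> U -> V) :
  (forall i, continuous (f i)) -> continuous (fun y => \sum_(i <- s | P i) f i y).
Proof.
move=> H; elim: s => [|i s IH].
  by under eq_fun do rewrite big_nil; move=> x; apply: cvg_cst.
under eq_fun do rewrite big_cons; case: (P i) => //.
by move=> x; apply: cvgD; [exact: H|exact: IH].
Qed.

(** An exponent of at least 2 bounds the difference quotient at 0 by [|h|], so the formulas on the
    two sides glue. *)
Lemma is_derive_pos_part_exp (k : nat) (u : R) :
  is_derive u (1 : R) (fun u : R => Num.max u 0 ^+ k.+2) (k.+2%:R * Num.max u 0 ^+ k.+1).
Proof.
have [u0|u0|->] := ltgtP u 0.
- rewrite expr0n/= mulr0.
  have H := is_derive_cst (0 : R) u (1 : R).
  apply: near_eq_is_derive H.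
  near=> y; have y0 : y < 0 by near: y; exact: lt_nbhsl.
  by rewrite /= max_r ?expr0n// ltW.
- have H : is_derive u (1 : R) (fun y : R => y ^+ k.+2) (k.+2%:R * u ^+ k.+1).
    apply: DeriveDef; first exact: exprn_derivable.
    by rewrite exp_derive /GRing.scale/= mulr1.
  apply: near_eq_is_derive H.
  near=> y; have y0 : 0 < y by near: y; exact: lt_nbhsr.
  by rewrite /= max_l// ltW.
- rewrite expr0n/= mulr0.
  have L : (fun h : R => h^-1 *: (((fun u : R => Num.max u 0 ^+ k.+2) \o shift 0) (h *: (1 : R)) - Num.max 0 0 ^+ k.+2)) @ 0^' --> (0 : R).
    apply/cvgr0Pnorm_lt => e e0.
    near=> h.
    have h1 : `|h| < 1 by near: h; exact: dnbhs0_lt.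
    have he : `|h| < e by near: h; exact: dnbhs0_lt.
    rewrite /= maxxx expr0n/= subr0 addr0 /GRing.scale/= mulr1.
    have [hp|hn] := leP h 0; first by rewrite expr0n/= mulr0 normr0.
    rewrite exprS mulKf ?gt_eqF//; apply: le_lt_trans he.
    rewrite normrX exprS -[leRHS]mulr1 ler_wpM2l// exprn_ile1// ltW//.
  by apply: DeriveDef; [apply/cvg_ex; exists 0|apply/cvg_lim].
Unshelve. all: by end_near. Qed.

Lemma continuous_add (T : topologicalType) (V : normedModType R) (f g : T -> V) :
  continuous f -> continuous g -> continuous (fun x => f x + g x).
Proof. by move=> Cf Cg x; apply: cvgD; [exact: Cf|exact: Cg]. Qed.

Lemma continuous_opp (T : topologicalType) (V : normedModType R) (f : T -> V) :
  continuous f -> continuous (fun x => - f x).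
Proof. by move=> Cf x; apply: cvgN; exact: Cf. Qed.

Lemma continuous_mul (T : topologicalType) (f g : T -> R) :
  continuous f -> continuous g -> continuous (fun x => f x * g x).
Proof. by move=> Cf Cg x; apply: cvgM; [exact: Cf|exact: Cg]. Qed.

Lemma continuous_identity (T : topologicalType) : continuous (fun x : T => x).
Proof. by move=> x; exact: cvg_id. Qed.

Lemma continuous_scale (T : topologicalType) (V : normedModType R) (f : T -> R) (w : V) :
  continuous f -> continuous (fun x => f x *: w).
Proof. by move=> Cf x; apply: cvgZ; [exact: Cf|exact: cvg_cst]. Qed.

Lemma continuous_compose (T T' T'' : topologicalType) (g : T' -> T'') (f : T -> T') :
  continuous g -> continuous f -> continuous (fun x => g (f x)).
Proof. by move=> Cg Cf x; exact: (cvg_comp _ _ (Cf x) (Cg _)). Qed.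

Lemma near_forall (T : topologicalType) (I : finType) (F : I -> T -> Prop) (q : T) :
  (forall i, \forall y \near q, F i y) -> \forall y \near q, forall i, F i y.
Proof. by move=> H; apply: filter_forall. Qed.

Lemma lipschitz_at_continuous (U : normedModType R) (f : U -> R) (q : U) (K e : R) :
  0 <= K -> 0 < e -> (forall x, `|x - q| < e -> `|f x - f q| <= K * `|x - q|) ->
  {for q, continuous f}.
Proof.
move=> K0 e0 H; apply/cvgrPdist_lt => eps eps0; near=> x.
have xe : `|x - q| < e.
  rewrite distrC; near: x; apply: (@cvgr_dist_lt _ _ _ (nbhs q) _ id q) => //; exact: cvg_id.
have xK : `|x - q| < eps / (K + 1).
  rewrite distrC; near: x; apply: (@cvgr_dist_lt _ _ _ (nbhs q) _ id q); first exact: cvg_id.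
  by rewrite divr_gt0// ltr_wpDl.
rewrite distrC; apply: (le_lt_trans (H _ xe)).
rewrite ltr_pdivlMr ?ltr_wpDl// in xK; apply: le_lt_trans xK.
by rewrite mulrC ler_wpM2l// lerDl.
Unshelve. all: by end_near. Qed.

Lemma continuous_pos_part : continuous (fun u : R => Num.max u 0).
Proof.
move=> u; apply: (@continuous_max R R id (cst 0) u); [exact: cvg_id|exact: cvg_cst].
Qed.
End DirectionalCalculus.

(** * C^1 and C^2 functions through their partial derivatives *)

Section Partials.
Variables (R : realType) (n : nat).
Implicit Types (f g : 'rV[R]_n -> R).

Lemma row_norm_le (M : 'rV[R]_n) (e : R) :
  0 <= e -> (forall i, `|M 0 i| <= e) -> `|M| <= e.
Proof.
move=> e0 H; rewrite /Num.norm/= mx_normrE; apply: bigmax_le => // -[i j] _ /=.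
by rewrite (ord1 i).
Qed.

Lemma coord_le_norm (M : 'rV[R]_n) i : `|M 0 i| <= `|M|.
Proof.
rewrite [leRHS]/Num.norm/= mx_normrE.
exact: (@le_bigmax _ _ _ _ (fun ij => `|M ij.1 ij.2|) (0, i)).
Qed.

Lemma evec_coord (i j : 'I_n) : evec R i 0 j = (j == i)%:R.
Proof. by rewrite /evec mxE eqxx. Qed.

Lemma evec_norm_le (i : 'I_n) : `|evec R i| <= 1.
Proof.
by apply: row_norm_le => // j; rewrite evec_coord; case: eqP; rewrite ?normr1 ?normr0.
Qed.

Lemma is_derive_coord (i j : 'I_n) (x : 'rV[R]_n) :
  is_derive x (evec R i) (fun y : 'rV[R]_n => y 0 j) ((j == i)%:R : R).
Proof.
apply/is_derive_at0; rewrite [X in is_derive _ _ X](_ : _ = fun t : R => x 0 j + t * (j == i)%:R).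
  by rewrite -[X in is_derive _ _ _ X]scale1r; apply: is_derive_affine; exact: is_derive_id.
by apply/funext => t; rewrite !mxE eqxx /= addrC.
Qed.

Lemma partialE (V : normedModType R) (f : 'rV[R]_n -> V) (df : 'rV[R]_n -> V) i :
  (forall x, is_derive x (evec R i) f (df x)) -> partial i f = df.
Proof. by move=> H; apply/funext => x; have [] := H x. Qed.

Lemma C1_intro (V : normedModType R) (f : 'rV[R]_n -> V) (df : 'I_n -> 'rV[R]_n -> V) :
  (forall i x, is_derive x (evec R i) f (df i x)) ->
  (forall i, continuous (df i)) -> C1 f.
Proof.
move=> H C i; split; first by move=> x; have [] := H i x.
by rewrite (partialE (H i)); apply: C.
Qed.

Lemma C1_is_derive (V : normedModType R) (f : 'rV[R]_n -> V) i x :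
  C1 f -> is_derive x (evec R i) f (partial i f x).
Proof. by move=> /(_ i)[H _]; apply/derivableP. Qed.

(** [C1] speaks of partial derivatives only, so continuity of [f] itself must be derived. The
    partials are bounded near [q]; moving from [q] to [x] one coordinate at a time, each step is
    controlled by the mean value theorem. In the sup norm the intermediate points do not leave the
    ball. *)
Lemma C1_locally_lipschitz f (q : 'rV[R]_n) : C1 f ->
  exists K e : R, [/\ 0 <= K, 0 < e &
    forall x, `|x - q| < e -> `|f x - f q| <= K * `|x - q|].
Proof.
move=> Cf; pose K := \sum_i (`|partial i f q| + 1).
have : \forall y \near q, forall i, `|partial i f y| <= K.
  apply: near_forall => i; have /cvgrPdist_lt/(_ _ ltr01) := (Cf i).2 q.
  apply: filterS => y /ltW H; rewrite /K (bigD1 i)//=.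
  apply: (@le_trans _ _ (`|partial i f q| + 1)); last first.
    by rewrite lerDl sumr_ge0// => j _; rewrite addr_ge0.
  rewrite -lerBlDl; apply: le_trans H; rewrite distrC; exact: lerB_dist.
move=> /nbhs_ballP[e /= e0 He].
have {}He y : `|y - q| < e -> forall i, `|partial i f y| <= K.
  by move=> yq; apply: He; rewrite -ball_normE /= distrC.
exists (n%:R * K), e.
have K0 : 0 <= K by apply: sumr_ge0 => i _; rewrite addr_ge0.
split => //; first by rewrite mulr_ge0.
move=> x xq.
pose z (k : nat) : 'rV[R]_n := \row_i (if (i < k)%N then x 0 i else q 0 i).
suff H k : (k <= n)%N -> `|f (z k) - f q| <= k%:R * K * `|x - q|.
  have zn : z n = x by apply/rowP => i; rewrite mxE ltn_ord.
  by have := H n (leqnn n); rewrite zn.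
elim: k => [_|k IH kn].
  have -> : z 0%N = q by apply/rowP => i; rewrite mxE.
  by rewrite subrr normr0 !mul0r.
pose i := Ordinal kn; pose a := x 0 i - q 0 i.
have aq : `|a| <= `|x - q| by have := coord_le_norm (x - q) i; rewrite !mxE.
have zS : z k.+1 = z k + a *: evec R i.
  apply/rowP => j; rewrite !mxE eqxx/= ltnS leq_eqVlt.
  have [->|ji] := eqVneq j i.
    by rewrite eqxx ltnn/= mulr1 /a addrC subrK.
  by rewrite (_ : (j == k :> nat) = false) ?mulr0 ?addr0//; apply/negbTE.
have [t ta E] := MVT_line (z k) a (Cf i).1.
rewrite -natr1 mulrDl mul1r mulrDl -(subrKA (f (z k))).
apply: (le_trans (ler_normD _ _)); rewrite [leRHS]addrC lerD//; last first.
  exact/IH/ltnW.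
rewrite zS E normrM mulrC ler_pM// ?He//.
apply: le_lt_trans xq; apply: row_norm_le => // j; rewrite !mxE eqxx/=.
have [->|ji] := eqVneq j i.
  by rewrite ltnn mulr1 addrAC subrr add0r (le_trans ta).
rewrite mulr0 addr0; case: ifP => _; last by rewrite subrr normr0.
by have := coord_le_norm (x - q) j; rewrite !mxE.
Qed.

Lemma C1_continuous f : C1 f -> continuous f.
Proof.
move=> Cf q; have [K [e [K0 e0 H]]] := C1_locally_lipschitz q Cf.
exact: lipschitz_at_continuous K0 e0 H.
Qed.

Lemma C1D f g : C1 f -> C1 g -> C1 (fun x => f x + g x).
Proof.
move=> Cf Cg; apply: (@C1_intro _ _ (fun i x => partial i f x + partial i g x)).
  by move=> i x; exact (is_derive_add (C1_is_derive i x Cf) (C1_is_derive i x Cg)).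
by move=> i; apply: continuous_add; [exact: (Cf i).2|exact: (Cg i).2].
Qed.

Lemma C1M f g : C1 f -> C1 g -> C1 (fun x => f x * g x).
Proof.
move=> Cf Cg.
apply: (@C1_intro _ _ (fun i x => f x * partial i g x + g x * partial i f x)).
  by move=> i x; exact (is_derive_mul (C1_is_derive i x Cf) (C1_is_derive i x Cg)).
move=> i; apply: continuous_add; apply: continuous_mul.
- exact: C1_continuous.
- exact: (Cg i).2.
- exact: C1_continuous.
- exact: (Cf i).2.
Qed.

Lemma continuous_shear g (i0 : 'I_n) : continuous g ->
  continuous (fun y : 'rV[R]_n => y + g y *: evec R i0).
Proof.
move=> Cg; apply: continuous_add; first exact: continuous_identity.
exact: continuous_scale.
Qed.

Lemma is_derive_comp_shear f g (i0 i : 'I_n) (x : 'rV[R]_n) :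
  C1 f -> C1 g ->
  is_derive x (evec R i) (fun y => f (y + g y *: evec R i0))
    (partial i f (x + g x *: evec R i0) +
     partial i g x * partial i0 f (x + g x *: evec R i0)).
Proof.
move=> Cf Cg.
apply: (@is_derive_shear_path _ _ f g (evec R i0) x (evec R i) (partial i g x)).
- exact: (Cf i0).1.
- exact: (Cf i0).2.
- exact: (Cf i).1.
- exact: C1_is_derive.
- exact: C1_continuous.
Qed.

Lemma C1_comp_shear f g (i0 : 'I_n) : C1 f -> C1 g ->
  C1 (fun y => f (y + g y *: evec R i0)).
Proof.
move=> Cf Cg; have CP := @continuous_shear g i0 (C1_continuous Cg).
apply: (C1_intro (fun i x => is_derive_comp_shear i0 i x Cf Cg)).
move=> i; apply: continuous_add; first exact (continuous_compose (Cf i).2 CP).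
apply: continuous_mul; first exact: (Cg i).2.
exact (continuous_compose (Cf i0).2 CP).
Qed.

Lemma partial_comp_shear f g (i0 i : 'I_n) : C1 f -> C1 g ->
  partial i (fun y => f (y + g y *: evec R i0)) =
  fun x => partial i f (x + g x *: evec R i0) +
     partial i g x * partial i0 f (x + g x *: evec R i0).
Proof. by move=> Cf Cg; apply: partialE => x; exact: is_derive_comp_shear. Qed.

(** The partials of the composite are sums and products of partials of [g] with partials of [f]
    composed with the same shear, so the C^1 case applies to them again. *)
Lemma C2_comp_shear f g (i0 : 'I_n) : C2 f -> C2 g ->
  C2 (fun y => f (y + g y *: evec R i0)).
Proof.
move=> [Cf Cdf] [Cg Cdg]; split; first exact: C1_comp_shear.
move=> i; rewrite (partial_comp_shear i0 i Cf Cg).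
exact (C1D (C1_comp_shear i0 (Cdf i) Cg) (C1M (Cdg i) (C1_comp_shear i0 (Cdf i0) Cg))).
Qed.

Lemma partial_affine g (i : 'I_n) (a w : 'rV[R]_n) : C1 g ->
  partial i (fun y => a + g y *: w) = fun x => partial i g x *: w.
Proof.
by move=> Cg; apply: partialE => x; exact (is_derive_affine a w (C1_is_derive i x Cg)).
Qed.

Lemma C1_affine g (a w : 'rV[R]_n) : C1 g -> C1 (fun y => a + g y *: w).
Proof.
move=> Cg.
apply: (C1_intro (fun i x => is_derive_affine a w (C1_is_derive i x Cg))).
by move=> i; apply: continuous_scale; exact: (Cg i).2.
Qed.

Lemma is_derive_shear g (i0 i : 'I_n) (x : 'rV[R]_n) : C1 g ->
  is_derive x (evec R i) (fun y : 'rV[R]_n => y + g y *: evec R i0)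
    (evec R i + partial i g x *: evec R i0).
Proof.
move=> Cg; have H := is_derive_affine 0 (evec R i0) (C1_is_derive i x Cg).
have := is_derive_add (is_derive_id x (evec R i)) H.
by congr (is_derive _ _ _ _); apply/funext => y; rewrite add0r.
Qed.

Lemma partial_shear g (i0 i : 'I_n) : C1 g ->
  partial i (fun y : 'rV[R]_n => y + g y *: evec R i0) =
  fun x => evec R i + partial i g x *: evec R i0.
Proof. by move=> Cg; apply: partialE => x; apply: is_derive_shear. Qed.

Lemma C2_shear g (i0 : 'I_n) : C2 g -> C2 (fun y : 'rV[R]_n => y + g y *: evec R i0).
Proof.
move=> [Cg Cdg]; split.
  apply: (C1_intro (fun i x => is_derive_shear i0 i x Cg)).
  move=> i; apply: continuous_add; first exact: cst_continuous.
  by apply: continuous_scale; exact: (Cg i).2.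
by move=> i; rewrite (partial_shear i0 i Cg); exact (C1_affine _ _ (Cdg i)).
Qed.
End Partials.

(** * C^2 bumps on cylinders, with explicit derivative bounds *)

Section Bump.
Variables (R : realType) (n : nat) (i0 : 'I_n) (delta : R).
Hypothesis delta_gt0 : 0 < delta.
Implicit Types c x : 'rV[R]_n.

Lemma C2_intro (f : 'rV[R]_n -> R) (df : 'I_n -> 'rV[R]_n -> R)
    (ddf : 'I_n -> 'I_n -> 'rV[R]_n -> R) :
  (forall i x, is_derive x (evec R i) f (df i x)) ->
  (forall i j x, is_derive x (evec R j) (df i) (ddf i j x)) ->
  (forall i j, continuous (ddf i j)) -> C2 f.
Proof.
move=> H1 H2 C.
have Cdf i : C1 (df i) by apply: (C1_intro (H2 i)) => j; exact: C.
split; first by apply: (C1_intro H1) => i; apply/C1_continuous/Cdf.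
by move=> i; rewrite (partialE (H1 i)).
Qed.

(** The coordinate [i0] is left out, so the bumps built from this are constant along [i0]; the shear
    along [i0] that they define is inverted by a change of sign. *)
Definition radial c x : R :=
  1 + - delta ^- 2 * \sum_(i | i != i0) (x 0 i - c 0 i) * (x 0 i - c 0 i).

Definition radial_pos c x : R := Num.max (radial c x) 0.

(** Three is the least integer power of a positive part that is C^2. *)
Definition bump c x : R := radial_pos c x ^+ 3.

Definition dradial c (i : 'I_n) x : R :=
  (- 2 * delta ^- 2) * ((i != i0)%:R * (x 0 i - c 0 i)).

Definition dbump c i x : R := dradial c i x * (3 * radial_pos c x ^+ 2).

Definition ddbump c i j x : R :=
  dradial c i x * (3 * (2 * radial_pos c x * dradial c j x)) +
  3 * radial_pos c x ^+ 2 * ((- 2 * delta ^- 2) * ((i != i0)%:R * (i == j)%:R)).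

Lemma is_derive_coordB c (i j : 'I_n) x :
  is_derive x (evec R j) (fun y : 'rV[R]_n => y 0 i - c 0 i) ((i == j)%:R : R).
Proof.
have H := is_derive_add (is_derive_coord j i x) (is_derive_cst (- c 0 i) x (evec R j)).
by apply: (is_derive_eq H); rewrite addr0.
Qed.

Lemma is_derive_radial c (j : 'I_n) x : is_derive x (evec R j) (radial c) (dradial c j x).
Proof.
have H i := is_derive_mul (is_derive_coordB c i j x) (is_derive_coordB c i j x).
have HS := is_derive_seq_sum (index_enum 'I_n) (fun i => i != i0) H.
have HD := is_derive_add (is_derive_cst (1 : R) x (evec R j)) (is_derive_mull (- delta ^- 2) HS).
apply: (is_derive_eq HD); rewrite add0r /dradial; have [ji|ji] := eqVneq j i0.
  rewrite mul0r mulr0 big1 ?mulr0// => i ii; by rewrite ji (negbTE ii) !mulr0 addr0.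
rewrite (bigD1 j)//= eqxx big1; first by rewrite !mulr1 mul1r; ring.
by move=> i /andP[_ ij]; rewrite (negbTE ij) !mulr0 addr0.
Qed.

Lemma is_derive_radial_pos_exp c (k : nat) (j : 'I_n) x :
  is_derive x (evec R j) (fun y => radial_pos c y ^+ k.+2)
    (k.+2%:R * radial_pos c x ^+ k.+1 * dradial c j x).
Proof. exact (is_derive_comp1 (is_derive_pos_part_exp k (radial c x)) (is_derive_radial c j x)). Qed.

Lemma is_derive_bump c (j : 'I_n) x : is_derive x (evec R j) (bump c) (dbump c j x).
Proof.
by apply: (is_derive_eq (is_derive_radial_pos_exp c 1 j x)); rewrite /dbump; ring.
Qed.

Lemma is_derive_dbump c (i j : 'I_n) x : is_derive x (evec R j) (dbump c i) (ddbump c i j x).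
Proof.
have H1 := is_derive_mull (- 2 * delta ^- 2)
  (is_derive_mull (i != i0)%:R (is_derive_coordB c i j x)).
have H2 := is_derive_mull 3 (is_derive_radial_pos_exp c 0 j x).
apply: (is_derive_eq (is_derive_mul H1 H2)); rewrite /ddbump /dradial expr1; ring.
Qed.

Lemma continuous_coordB c (i : 'I_n) : continuous (fun y : 'rV[R]_n => y 0 i - c 0 i).
Proof. by apply: continuous_add; [exact: coord_continuous|exact: cst_continuous]. Qed.

Lemma continuous_dradial c i : continuous (dradial c i).
Proof.
by do 2![apply: continuous_mul; first exact: cst_continuous]; exact: continuous_coordB.
Qed.

Lemma continuous_radial_pos c : continuous (radial_pos c).
Proof.
apply: (continuous_compose (@continuous_pos_part R)).
apply: C1_continuous; apply: (C1_intro (is_derive_radial c)) => i; exact: continuous_dradial.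
Qed.

Lemma continuous_ddbump c i j : continuous (ddbump c i j).
Proof.
have C := @continuous_radial_pos c; have D := @continuous_dradial c.
have K (a : R) : continuous (fun _ : 'rV[R]_n => a) by exact: cst_continuous.
apply: continuous_add.
  apply: continuous_mul => //; apply: continuous_mul => //.
  by apply: continuous_mul => //; apply: continuous_mul.
by apply: continuous_mul => //; apply: continuous_mul => //; apply: continuous_mul.
Qed.

Lemma radial_pos_ge0 c x : 0 <= radial_pos c x.
Proof. by rewrite le_max lexx orbT. Qed.

Lemma radial_pos_le1 c x : radial_pos c x <= 1.
Proof.
rewrite ge_max ler01 andbT /radial mulNr gerBl mulr_ge0//.
  by rewrite invr_ge0 exprn_ge0// ltW.
by apply: sumr_ge0 => i _; rewrite -expr2 sqr_ge0.
Qed.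

Lemma radial_pos_support c x i :
  radial_pos c x != 0 -> i != i0 -> `|x 0 i - c 0 i| < delta.
Proof.
move=> m0 ii; have : 0 < radial c x.
  by rewrite ltNge; apply: contra m0 => h; rewrite /radial_pos max_r.
rewrite /radial mulNr subr_gt0 mulrC ltr_pdivrMr ?exprn_gt0// mul1r => h.
rewrite -(ltr_pXn2r (_ : 0 < 2)%N) ?nnegrE ?(ltW delta_gt0)// real_normK ?num_real//.
apply: le_lt_trans h; rewrite (bigD1 i)//= -expr2 lerDl.
by apply: sumr_ge0 => j _; rewrite -expr2 sqr_ge0.
Qed.

Lemma bump_center c x : (forall i, i != i0 -> x 0 i = c 0 i) -> bump c x = 1.
Proof.
move=> H; rewrite /bump /radial_pos /radial big1 ?mulr0 ?addr0 ?max_l ?expr1n//.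
by move=> i ii; rewrite H// subrr mul0r.
Qed.

Lemma bump_norm_le c x : `|bump c x| <= 1.
Proof.
by rewrite ger0_norm ?exprn_ge0 ?radial_pos_ge0// exprn_ile1 ?radial_pos_ge0 ?radial_pos_le1.
Qed.

Lemma dradial_norm_le c i x : radial_pos c x != 0 -> `|dradial c i x| <= 2 / delta.
Proof.
move=> m0; rewrite /dradial; have [ii|ii] := eqVneq i i0.
  by rewrite mul0r mulr0 normr0 divr_ge0// ltW.
rewrite mul1r normrM normrM normrN normr_nat ger0_norm ?invr_ge0 ?exprn_ge0 ?(ltW delta_gt0)//.
apply: (@le_trans _ _ (2 * delta ^- 2 * delta)).
  rewrite ler_wpM2l ?mulr_ge0 ?invr_ge0 ?exprn_ge0 ?(ltW delta_gt0)//.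
  by rewrite ltW// radial_pos_support.
by rewrite le_eqVlt; apply/orP; left; apply/eqP; field; rewrite gt_eqF.
Qed.

Lemma dbump_norm_le c i x : `|dbump c i x| <= 6 / delta.
Proof.
have [m0|m0] := eqVneq (radial_pos c x) 0.
  by rewrite /dbump m0 expr0n/= !mulr0 normr0 divr_ge0// ltW.
rewrite /dbump normrM (_ : 6 / delta = 2 / delta * 3); last by field; rewrite gt_eqF.
apply: ler_pM => //; first exact: dradial_norm_le.
rewrite normrM normr_nat -[leRHS]mulr1 ler_wpM2l// ger0_norm ?exprn_ge0 ?radial_pos_ge0//.
by rewrite exprn_ile1 ?radial_pos_ge0 ?radial_pos_le1.
Qed.

Lemma ddbump_norm_le c i j x : `|ddbump c i j x| <= 30 / delta ^+ 2.
Proof.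
have d2 : 0 <= delta ^- 2 by rewrite invr_ge0 exprn_ge0// ltW.
have [m0|m0] := eqVneq (radial_pos c x) 0.
  rewrite /ddbump m0 expr0n/= !(mulr0, mul0r) addr0 normr0 mulr_ge0//.
have mm : `|radial_pos c x| <= 1.
  by rewrite ger0_norm ?radial_pos_ge0 ?radial_pos_le1.
(* The product of two first derivatives of [radial] accounts for 24, its second derivative for 6. *)
have -> : 30 / delta ^+ 2 = 2 / delta * (3 * (2 * 1 * (2 / delta))) + 3 * 1 * (2 * delta ^- 2 * 1).
  by field; rewrite gt_eqF.
have dd k := dradial_norm_le k m0.
have m2 : `|radial_pos c x ^+ 2| <= 1 by rewrite normrX exprn_ile1.
apply: (le_trans (ler_normD _ _)); apply: lerD; rewrite normrM.
  apply: ler_pM => //; rewrite normrM normr_nat ler_wpM2l// normrM.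
  by apply: ler_pM => //; rewrite normrM normr_nat ler_wpM2l.
apply: ler_pM => //; first by rewrite normrM normr_nat ler_wpM2l.
rewrite normrM; apply: ler_pM => //.
  by rewrite normrM normrN normr_nat (ger0_norm d2).
by rewrite -natrM normr_nat; case: (i != i0); case: (i == j).
Qed.

End Bump.

(** * The perturbation: lift, sine tilts and disjoint bumps *)

Lemma norm_sum_disjoint (R : realType) (J : finType) (F : J -> R) (K : R) :
  0 <= K -> (forall j, `|F j| <= K) ->
  (forall j j', F j != 0 -> F j' != 0 -> j = j') -> `|\sum_j F j| <= K.
Proof.
move=> K0 FK D; have [/existsP[j Fj]|/existsPn H] := boolP [exists j, F j != 0].
  rewrite (bigD1 j)//= big1 ?addr0// => j' jj'; apply/eqP; apply: contraNT jj' => Fj'.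
  by rewrite (D _ _ Fj Fj').
by rewrite big1 ?normr0// => j _; apply/eqP; rewrite -[_ == _]negbK.
Qed.

Section Perturbation.
Variables (R : realType) (n : nat) (i0 : 'I_n) (delta : R) (J : finType).
Variables (t eta eps : R) (theta : 'I_n -> R) (p : 'rV[R]_n) (a : J -> R) (c : J -> 'rV[R]_n).
Hypothesis delta01 : 0 < delta <= 1.
Hypothesis theta_le : forall i, `|theta i| <= eta.
Hypothesis a_le : forall j, `|a j| <= eps * delta ^+ 2.
Hypothesis eps_ge0 : 0 <= eps.
Hypothesis separated : forall j j', j != j' ->
  exists2 i, i != i0 & 2 * delta <= `|c j 0 i - c j' 0 i|.

Definition perturbation (x : 'rV[R]_n) : R :=
  t + (\sum_(i | i != i0) theta i * sin (x 0 i - p 0 i) +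
       \sum_j a j * bump i0 delta (c j) x).

Definition dperturbation i (x : 'rV[R]_n) : R :=
  (i != i0)%:R * theta i * cos (x 0 i - p 0 i) +
  \sum_j a j * dbump i0 delta (c j) i x.

Definition ddperturbation i k (x : 'rV[R]_n) : R :=
  (i != i0)%:R * theta i * (- sin (x 0 i - p 0 i) * (i == k)%:R) +
  \sum_j a j * ddbump i0 delta (c j) i k x.

Let delta_gt0 : 0 < delta. Proof. by case/andP: delta01. Qed.

Lemma is_derive_perturbation k x :
  is_derive x (evec R k) perturbation (dperturbation k x).
Proof.
have H1 i := is_derive_mull (theta i)
  (@is_derive_comp1 _ _ sin (fun y : 'rV[R]_n => y 0 i - p 0 i) x _ _ _
     (is_derive_sin (x 0 i - p 0 i)) (is_derive_coordB p i k x)).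
have H2 j := is_derive_mull (a j) (is_derive_bump i0 delta (c j) k x).
have H3 := is_derive_seq_sum (index_enum 'I_n) (fun i => i != i0) H1.
have H4 := is_derive_seq_sum (index_enum J) xpredT H2.
apply: (is_derive_eq (is_derive_add (is_derive_cst t x (evec R k)) (is_derive_add H3 H4))).
rewrite add0r; congr (_ + _); have [ki|ki] := eqVneq k i0.
  by rewrite big1 ?mul0r// => i ii; rewrite ki (negbTE ii) !mulr0.
rewrite (bigD1 k)//= eqxx big1 ?addr0 ?mulr1 ?mul1r//.
by move=> i /andP[_ ik]; rewrite (negbTE ik) !mulr0.
Qed.

Lemma is_derive_dperturbation i k x :
  is_derive x (evec R k) (dperturbation i) (ddperturbation i k x).
Proof.
have H1 := is_derive_mull ((i != i0)%:R * theta i)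
  (@is_derive_comp1 _ _ cos (fun y : 'rV[R]_n => y 0 i - p 0 i) x _ _ _
     (is_derive_cos (x 0 i - p 0 i)) (is_derive_coordB p i k x)).
have H2 j := is_derive_mull (a j) (is_derive_dbump i0 delta (c j) i k x).
exact (is_derive_add H1 (is_derive_seq_sum (index_enum J) xpredT H2)).
Qed.

Lemma C2_perturbation : C2 perturbation.
Proof.
apply: (C2_intro is_derive_perturbation is_derive_dperturbation) => i k.
have K (b : R) : continuous (fun _ : 'rV[R]_n => b) by exact: cst_continuous.
apply: continuous_add; last first.
  apply: continuous_seq_sum => j; apply: continuous_mul => //; exact: continuous_ddbump.
apply: continuous_mul => //; apply: continuous_mul => //.
have S : continuous (fun y : R => - sin y).
  by move=> y; apply: cvgN; exact: continuous_sin.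
exact (continuous_compose S (@continuous_coordB _ _ p i)).
Qed.

Lemma partial_perturbation i : partial i perturbation = dperturbation i.
Proof. by apply: partialE => x; exact: is_derive_perturbation. Qed.

Lemma partial2_perturbation i k : partial k (partial i perturbation) = ddperturbation i k.
Proof.
by rewrite partial_perturbation; apply: partialE => x; exact: is_derive_dperturbation.
Qed.

(** Stated for a general [F] to cover the bumps and their derivatives of both orders. Centres
    [2 * delta] apart in a coordinate other than [i0] have disjoint supports, so the sum costs no
    more than one bump, however many there are. *)
Lemma bump_sum_norm_le (F : J -> 'rV[R]_n -> R) (K : R) x :
  0 <= K -> (forall j, `|F j x| <= K) ->
  (forall j, radial_pos i0 delta (c j) x = 0 -> F j x = 0) ->
  `|\sum_j a j * F j x| <= eps * delta ^+ 2 * K.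
Proof.
move=> K0 FK F0; apply: norm_sum_disjoint.
- by rewrite !mulr_ge0// ltW.
- by move=> j; rewrite normrM; apply: ler_pM.
have sup j : a j * F j x != 0 -> radial_pos i0 delta (c j) x != 0.
  by apply: contra => /eqP/F0 ->; rewrite mulr0.
move=> j j' /sup m0 /sup m0'; apply/eqP; apply: contrapT => /negP/separated[i ii].
apply/negP; rewrite -ltNge.
have h := radial_pos_support delta_gt0 m0 ii; have h' := radial_pos_support delta_gt0 m0' ii.
by move: h h'; rewrite !ltr_distl => /andP[? ?] /andP[? ?]; apply/andP; split; lra.
Qed.

(** One bound serves values, first and second derivatives: as [delta <= 1], the bumps cost most in
    second order, namely [eps * delta^2 * (30 / delta^2)]. *)
Let bound := `|t| + n%:R * eta + 30 * eps.

Let eta_ge0 : 0 <= eta. Proof. exact: le_trans (theta_le i0). Qed.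

Let eta_le : eta <= n%:R * eta.
Proof. by rewrite ler_peMl// ler1n; case: n i0 => [[]|]. Qed.

Lemma perturbation_norm_le x : `|perturbation x| <= bound.
Proof.
rewrite /perturbation /bound -addrA; apply: (le_trans (ler_normD _ _)); rewrite lerD2l.
apply: (le_trans (ler_normD _ _)); apply: lerD.
  apply: (le_trans (ler_norm_sum _ _ _)).
  apply: (@le_trans _ _ (\sum_(i < n) eta)); last by rewrite sumr_const card_ord mulr_natl.
  rewrite big_mkcond/=; apply: ler_sum => i _; case: ifP => _ //.
  by rewrite normrM -[leRHS]mulr1; apply: ler_pM => //; exact: sin_max.
have /andP[d0 d1] := delta01.
apply: (le_trans (@bump_sum_norm_le (fun j => bump i0 delta (c j)) 1 x _ _ _)) => //.
- by move=> j; exact: bump_norm_le.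
- by move=> j; rewrite /bump => ->; rewrite expr0n.
have h : delta ^+ 2 <= 1 by rewrite exprn_ile1// ltW.
apply: (@le_trans _ _ (eps * 1)); first by rewrite mulr1 ler_wpM2l.
by rewrite [leRHS]mulrC ler_wpM2l// ler1n.
Qed.

Lemma partial_perturbation_norm_le i x : `|partial i perturbation x| <= bound.
Proof.
have /andP[d0 d1] := delta01.
rewrite partial_perturbation /dperturbation /bound -addrA.
apply: (@le_trans _ _ (n%:R * eta + 30 * eps)); last by rewrite lerDr.
apply: (le_trans (ler_normD _ _)); apply: lerD.
  apply: le_trans eta_le; rewrite -[leRHS]mulr1 normrM; apply: ler_pM => //; last exact: cos_max.
  by case: (i != i0); rewrite ?mul1r// mul0r normr0.
apply: (le_trans (@bump_sum_norm_le (fun j => dbump i0 delta (c j) i) (6 / delta) x _ _ _)) => //.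
- by rewrite divr_ge0// ltW.
- by move=> j; exact: dbump_norm_le.
- by move=> j; rewrite /dbump => ->; rewrite expr0n/= !mulr0.
have -> : eps * delta ^+ 2 * (6 / delta) = eps * (6 * delta) by field; rewrite gt_eqF.
by rewrite [leRHS]mulrC ler_wpM2l//; lra.
Qed.

Lemma partial2_perturbation_norm_le i k x :
  `|partial k (partial i perturbation) x| <= bound.
Proof.
have /andP[d0 d1] := delta01.
rewrite partial2_perturbation /ddperturbation /bound -addrA.
apply: (@le_trans _ _ (n%:R * eta + 30 * eps)); last by rewrite lerDr.
apply: (le_trans (ler_normD _ _)); apply: lerD.
  apply: le_trans eta_le; rewrite -[leRHS]mulr1 normrM; apply: ler_pM => //.
    by case: (i != i0); rewrite ?mul1r// mul0r normr0.
  rewrite normrM normrN -[leRHS]mulr1; apply: ler_pM => //; first exact: sin_max.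
  by rewrite normr_nat; case: (i == k).
apply: (le_trans (@bump_sum_norm_le (fun j => ddbump i0 delta (c j) i k) (30 / delta ^+ 2) x _ _ _)) => //.
- by rewrite divr_ge0// exprn_ge0// ltW.
- by move=> j; exact: ddbump_norm_le.
- by move=> j; rewrite /ddbump => ->; rewrite expr0n/= !(mulr0, mul0r) addr0.
by have -> : eps * delta ^+ 2 * (30 / delta ^+ 2) = 30 * eps by field; rewrite gt_eqF.
Qed.

Lemma perturbation_shear (x : 'rV[R]_n) s : perturbation (x + s *: evec R i0) = perturbation x.
Proof.
have E i : i != i0 -> (x + s *: evec R i0) 0 i = x 0 i.
  by move=> ii; rewrite !mxE eqxx/= (negbTE ii) mulr0 addr0.
rewrite /perturbation; congr (_ + (_ + _)); first by apply: eq_bigr => i /E ->.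
apply: eq_bigr => j _; rewrite /bump /radial_pos /radial.
by under eq_bigr => i /E -> do [].
Qed.

Lemma perturbation_center j (x : 'rV[R]_n) : (forall i, i != i0 -> x 0 i = c j 0 i) ->
  perturbation x = t + (\sum_(i | i != i0) theta i * sin (c j 0 i - p 0 i) + a j).
Proof.
move=> H; rewrite /perturbation; congr (_ + (_ + _)).
  by apply: eq_bigr => i /H ->.
rewrite (bigD1 j)//= bump_center// mulr1 big1 ?addr0// => j' jj'.
have [i ii h] := separated jj'.
rewrite /bump; have [->|/(radial_pos_support delta_gt0)/(_ ii)] := eqVneq (radial_pos i0 delta (c j') x) 0.
  by rewrite expr0n mulr0.
rewrite H// => h'; move: h; rewrite leNgt distrC (lt_trans h')//.
by rewrite ltr_pMl// ltr1n.
Qed.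
End Perturbation.

(** * Surface points over a ball of a coordinate hyperplane *)

Section Sections.
Variable R : realType.

(** Mean value theorem where [cos >= 1 / 2]. It ensures that a sine tilt separates two lattice
    columns at a rate comparable to their distance. *)
Lemma sin_bilipschitz_at0 : exists2 r : R, 0 < r & forall x y : R,
  `|x| <= r -> `|y| <= r -> 2^-1 * `|x - y| <= `|sin x - sin y| <= `|x - y|.
Proof.
have /cvgrPdist_lt/(_ 2^-1) := @continuous_cos R 0.
rewrite invr_gt0 ltr0n => /(_ isT)/nbhs_ballP[e /= e0 He].
have {}He z : `|z| < e -> 2^-1 <= cos z.
  move=> ze; have := He z; rewrite -ball_normE/= sub0r normrN cos0 => /(_ ze).
  by rewrite ltr_distl => /andP[]; lra.
exists (e / 4) => [|x y xr yr]; first by rewrite divr_gt0.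
have [t] := @MVT_line R R sin y 1 (x - y) (fun z => @derivable_sin R z).
have scal (z : R) : z *: (1 : R) = z by rewrite /GRing.scale/= mulr1.
rewrite !scal [y + (x - y)]addrC subrK => txy ->.
have -> : 'D_1 sin (y + t) = cos (y + t) by exact: derive_val.
have xy : `|x - y| <= e / 2.
  by apply: (le_trans (ler_normB _ _)); apply: (le_trans (lerD xr yr)); lra.
have : 2^-1 <= cos (y + t).
  apply: He; apply: (le_lt_trans (ler_normD _ _)); apply: (le_lt_trans (lerD yr (le_trans txy xy))).
  by lra.
move=> c1; rewrite normrM; apply/andP; split.
  by rewrite mulrC ler_wpM2l// ger0_norm// (le_trans _ c1).
by rewrite -[leRHS]mulr1 ler_wpM2l// cos_max.
Qed.

Lemma derivative_sign (U : normedModType R) (f : U -> R) (x v : U) :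
  derivable f x v -> f x = 0 -> 'D_v f x != 0 ->
  exists2 e : R, 0 < e & forall h : R, h != 0 -> `|h| < e ->
    0 < h^-1 * f (h *: v + x) * 'D_v f x.
Proof.
set D := 'D_v f x => fv fx0 D0.
have /cvgrPdist_lt/(_ `|D|) : (fun h : R => h^-1 *: ((f \o shift x) (h *: v) - f x)) @ 0^' --> D by [].
rewrite normr_gt0 => /(_ D0) H.
have {H} : \forall h \near (0 : R)^', `|D - h^-1 * f (h *: v + x)| < `|D|.
  by apply: filterS H => h; rewrite /= fx0 subr0.
move=> /nbhs_ballP[e /= e0 He]; exists e => // h h0 he.
have {He} := He h; rewrite -ball_normE/= sub0r normrN => /(_ he h0).
set z := h^-1 * _; rewrite ltr_distl.
have [Dp|Dn|/eqP] := ltgtP D 0; last by rewrite (negbTE D0).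
  rewrite ltr0_norm// => /andP[? ?]; rewrite nmulr_lgt0//; lra.
rewrite gtr0_norm// => /andP[? ?]; rewrite pmulr_lgt0//; lra.
Qed.

Variable n : nat.

(** A nonzero derivative along [i0] makes [F] change sign between [p - s0 e0] and [p + s0 e0]. By
    continuity the change persists on nearby parallel segments, and the intermediate value theorem
    finds a zero on each. *)
Lemma hypersurface_section (S : set 'rV[R]_n) (p : 'rV[R]_n) :
  C2_hypersurface S -> S p ->
  exists i0 : 'I_n, exists2 r : R, 0 < r & forall x : 'rV[R]_n,
    (forall i, i != i0 -> `|x 0 i - p 0 i| <= r) ->
    exists s : R, S (x + s *: evec R i0).
Proof.
move=> HS Sp; have [U [F [oU Up [CF _] gradF US]]] := HS p Sp.
have [i0 D0] := gradF p Up Sp; exists i0.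
set D := partial i0 F p in D0; set e0 := evec R i0.
have Fp : F p = 0 by have : (U `&` S) p by []; rewrite US => -[].
have [e1 e1_gt0 He1] := derivative_sign ((CF i0).1 p) Fp D0.
have /nbhs_ballP[e2 /= e2_gt0 He2] : nbhs p U by apply: open_nbhs_nbhs.
have {}He2 y : `|y - p| < e2 -> U y.
  by move=> yp; apply: He2; rewrite -ball_normE/= distrC.
pose s0 := Num.min e1 e2 / 2.
have s0_gt0 : 0 < s0 by rewrite divr_gt0// lt_min e1_gt0.
have s0e1 : s0 < e1 by rewrite ltr_pdivrMr// (le_lt_trans (_ : _ <= e1))// ?ge_min ?lexx// ltr_pMr// ltr1n.
have s0e2 : s0 < e2 by rewrite ltr_pdivrMr// (le_lt_trans (_ : _ <= e2))// ?ge_min ?lexx ?orbT// ltr_pMr// ltr1n.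
have CFc := C1_continuous CF.
(* The factor [D] treats both signs of the derivative at once: [F * D] has the sign of [s] near
   [p + s e0]. *)
have sgn (s : R) : s != 0 -> `|s| < e1 -> exists2 r : R, 0 < r &
    forall y, `|y - (p + s *: e0)| < r -> 0 < s^-1 * (F y * D).
  move=> s_neq0 se1; have pos : 0 < s^-1 * (F (p + s *: e0) * D).
    by rewrite mulrA [p + _]addrC; exact: He1.
  have : s^-1 * (F y * D) @[y --> p + s *: e0] --> s^-1 * (F (p + s *: e0) * D).
    apply: (@continuous_mul R 'rV[R]_n (fun=> s^-1) (fun y => F y * D)); first exact: cst_continuous.
    by apply: continuous_mul => //; exact: cst_continuous.
  move=> /cvgrPdist_lt/(_ _ pos)/nbhs_ballP[r /= r0 Hr]; exists r => // y yr.
  have := Hr y; rewrite -ball_normE/= distrC => /(_ yr).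
  set A := s^-1 * (F y * D); set B := s^-1 * _ in pos *.
  by rewrite ltr_distl => /andP[]; lra.
have [||r1 r1_gt0 Hr1] := sgn s0; [by rewrite gt_eqF|by rewrite gtr0_norm|].
have [||r2 r2_gt0 Hr2] := sgn (- s0); [by rewrite oppr_eq0 gt_eqF|by rewrite normrN gtr0_norm|].
pose r := Num.min (Num.min r1 r2) e2 / 2.
have m_gt0 : 0 < Num.min (Num.min r1 r2) e2 by rewrite !lt_min r1_gt0 r2_gt0.
have r_gt0 : 0 < r by rewrite divr_gt0.
have rm : r < Num.min (Num.min r1 r2) e2 by rewrite ltr_pdivrMr// ltr_pMr// ltr1n.
move: (rm); rewrite !lt_min => /andP[/andP[rr1 rr2] re2].
exists r => // x xp.
(* Coordinate [i0] of [x] is arbitrary; resetting it to that of [p] gives a point close to [p] on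
   the same line. *)
pose q := x + (p 0 i0 - x 0 i0) *: e0.
have qp : `|q - p| <= r.
  apply: row_norm_le; first exact: ltW.
  move=> i; rewrite !mxE eqxx/=; have [->|ii] := eqVneq i i0.
    by rewrite mulr1 [x 0 i0 + _]addrC subrK subrr normr0 ltW.
  by rewrite mulr0 addr0; apply: xp.
have sh s : q + s *: e0 - (p + s *: e0) = q - p by rewrite opprD addrACA subrr addr0.
have pos : 0 < s0^-1 * (F (q + s0 *: e0) * D) by apply: Hr1; rewrite sh (le_lt_trans qp).
have neg : 0 < (- s0)^-1 * (F (q + - s0 *: e0) * D) by apply: Hr2; rewrite sh (le_lt_trans qp).
have {}pos : 0 < F (q + s0 *: e0) * D by move: pos; rewrite pmulr_rgt0// invr_gt0.
have {}neg : F (q + - s0 *: e0) * D < 0 by move: neg; rewrite nmulr_rgt0// invr_lt0 oppr_lt0.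
pose phi (s : R) := F (q + s *: e0) * D.
have [|||s] := @IVT R phi (- s0) s0 0.
- by rewrite ge0_cp// ltW.
- apply: continuous_subspaceT; apply: continuous_mul; last exact: cst_continuous.
  apply: (continuous_compose CFc); apply: continuous_add; first exact: cst_continuous.
  by apply: continuous_scale; exact: continuous_identity.
- by rewrite ge_min le_max (ltW pos) (ltW neg) orbT.
rewrite in_itv/= => /andP[s1 s2] /eqP; rewrite mulf_eq0 (negbTE D0) orbF => /eqP Fs.
exists (p 0 i0 - x 0 i0 + s); rewrite scalerDl addrA -/e0 -/q.
have Uq : U (q + s *: e0).
  apply: He2; apply: (@le_lt_trans _ _ (Num.max r s0)); last by rewrite gt_max re2.
  apply: row_norm_le; first by rewrite le_max ltW.
  move=> i; rewrite !mxE eqxx/=; have [->|ii] := eqVneq i i0.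
    rewrite !mulr1 le_max; apply/orP; right.
    by rewrite [x 0 i0 + _]addrC subrK addrAC subrr add0r ler_norml s1.
  by rewrite !mulr0 !addr0 le_max xp.
suff : (U `&` S) (q + s *: e0) by case.
by rewrite US.
Qed.
End Sections.

(** * Choice of the tilt, the lift and the scale *)

(** Heights modulo 1 are sorted into [A = D * M^d] arcs. Two columns of a cube share an arc with
    probability at most [(3 + 12 / eta) / A], and the lower bound on [D] makes this at most
    [1 / (2 * M^d)], as the averaging requires. A frequent arc supplies the lift [tau]. *)
Lemma many_hits (R : realType) (d M N D : nat) (eta : R)
    (phi : {ffun 'I_d -> 'I_N} -> {ffun 'I_d -> 'I_M} -> R)
    (g : {ffun 'I_d -> 'I_N} -> {ffun 'I_d -> 'I_M} -> 'I_d -> R) :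
  0 < eta <= 1 -> (0 < M)%N -> (0 < N)%N -> 2 * (3 + 12 / eta) <= D%:R ->
  (forall j (u u' : {ffun 'I_d -> 'I_M}) k, u k != u' k ->
     2^-1 <= `|g j u k - g j u' k| <= M%:R) ->
  exists (theta : 'I_d -> R) (tau : R) (G : {set {ffun 'I_d -> 'I_N}})
         (u : {ffun 'I_d -> 'I_N} -> {ffun 'I_d -> 'I_M}),
    [/\ forall k, `|theta k| <= eta, 0 <= tau <= 1, (N ^ d <= 2 * D * #|G|)%N &
        forall j, j \in G -> exists z : int,
          0 <= phi j (u j) + \sum_k theta k * g j (u j) k - tau - z%:~R
            < (D * M ^ d)%:R^-1].
Proof.
move=> eta01 M0 N0 DC gP; have /andP[eta0 eta1] := eta01.
have C0 : 3 <= 3 + 12 / eta by rewrite lerDl divr_ge0// ltW.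
have D2 : (2 <= D)%N by rewrite -(ler_nat R); lra.
set A := (D * M ^ d)%N; pose A' := A.-1.
have Md0 : (0 < M ^ d)%N by rewrite expn_gt0 M0.
have A2 : (2 <= A)%N by rewrite -[2%N]muln1 leq_mul.
have AE : A'.+1 = A by rewrite prednK// ltnW.
have A0 : 0 < A%:R :> R by rewrite ltr0n ltnW.
(* With this many grid values per tilt, one grid step moves a height difference by at most
   [1 / A]. *)
pose B := (M * A)%N.
have B0 : (0 < B)%N by rewrite muln_gt0 M0 ltnW.
have B0R : 0 < B%:R :> R by rewrite ltr0n.
pose th (b : {ffun 'I_d -> 'I_B}) k : R := eta * (b k)%:R / B%:R.
pose v b j u := phi j u + \sum_k th b k * g j u k.
pose res b j u := residue A' (v b j u).
have coll j (u u' : {ffun 'I_d -> 'I_M}) : u != u' ->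
    (#|[set b | res b j u == res b j u']%SET| * (2 * #|{ffun 'I_d -> 'I_M}|) <=
     #|{ffun 'I_d -> 'I_B}|)%N.
  move=> uu'; have [k kP] : exists k, u k != u' k.
    apply/existsP; apply: contraNT uu'; rewrite negb_exists => /forallP H.
    by apply/eqP/ffunP => k; apply/eqP; rewrite -[_ == _]negbK.
  rewrite !card_ffun !card_ord -(ler_nat R) !natrM.
  have MAB : M%:R * A%:R <= B%:R :> R by rewrite -natrM.
  have := @card_near_int_ffun R d B A eta M%:R (phi j u - phi j u')
    (fun k => g j u k - g j u' k) k eta01 (gP j u u' k kP) A2 MAB.
  set X := #|_|%:R; set Y := #|_|%:R => XA.
  have YX : Y <= X.
    rewrite ler_nat subset_leq_card//; apply/fintype.subsetP => b; rewrite !inE => /eqP/residue_eq_near_int.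
    rewrite AE => -[z zP]; exists z; congr (`| _ - _ | < _) : zP.
    rewrite /v opprD addrACA -sumrB; congr (_ + _); apply: eq_bigr => k' _.
    by rewrite -mulrBr.
  have {XA} : Y * A%:R <= (3 + 12 / eta) * (B ^ d)%:R.
    by apply: le_trans XA; rewrite ler_pM2r.
  rewrite /A natrM => h.
  have C00 : 0 < 3 + 12 / eta by apply: lt_le_trans C0.
  rewrite -(ler_pM2l C00); apply: le_trans h.
  rewrite mulrCA ler_wpM2l// mulrA ler_wpM2r//.
  by rewrite mulrC.
have [|||b [tau hit]] := @exists_frequent_value _ _ _ _ res _ _ _ coll.
- by rewrite card_ffun !card_ord expn_gt0 B0.
- by rewrite card_ffun !card_ord expn_gt0 N0.
- by rewrite card_ffun !card_ord expn_gt0 M0.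
set G := [set j | _]%SET in hit.
pose u0 : {ffun 'I_d -> 'I_M} := [ffun=> Ordinal M0].
(* The default column is taken only for cubes outside [G], about which nothing is claimed. *)
pose uj j := odflt u0 [pick u | res b j u == tau].
exists (th b), (tau%:R / A%:R), G, uj; split.
- move=> k; rewrite /th !normrM normfV !normr_nat (gtr0_norm eta0) -mulrA -[leRHS]mulr1.
  by rewrite ler_wpM2l ?(ltW eta0)// ler_pdivrMr// mul1r ler_nat ltnW.
- rewrite divr_ge0//= ler_pdivrMr// mul1r ler_nat.
  exact: (leq_trans (ltnW (ltn_ord tau)) (eq_leq AE)).
- move: hit; rewrite !card_ffun !card_ord AE -/A /A mulnA -mulnA [(M ^ d * _)%N]mulnC mulnA.
  by rewrite leq_pmul2r.
move=> j; rewrite inE => /existsP[u1 u1P].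
have rj : res b j (uj j) = tau.
  by rewrite /uj; case: pickP => [u /eqP//|/(_ u1)]; rewrite u1P.
have AER : A'.+1%:R = A%:R :> R by rewrite AE.
by have [z] := residueP A' (v b j (uj j)); rewrite -/(res _ _ _) rj AER => zP; exists z.
Qed.

(** With [kappa] the [(n+1)]-st root of [rho], the last equation is the identity n - 2 + 2/(n+1) =
    n(n-1)/(n+1). The integer side [M] of the cubes is [kappa] rounded down. *)
Lemma scale_exists (R : realType) (n : nat) (rho : R) : (2 <= n)%N -> 1 <= rho ->
  exists (kappa : R) (M : nat), [/\ (0 < M)%N, 1 <= kappa, M%:R <= kappa < M.+1%:R,
    kappa ^+ n.+1 = rho & rho `^ (n%:R - 2 + 2 / (n%:R + 1)) = kappa ^+ (n * n.-1)].
Proof.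
move=> n2 rho1; have rho0 : 0 <= rho by apply: le_trans rho1.
set kappa := rho `^ (n.+1%:R^-1).
have k1 : 1 <= kappa.
  by rewrite -(powRr0 rho); apply: ler_powR => //; rewrite invr_ge0.
have k0 : 0 <= kappa by apply: le_trans k1.
have /andP[t1 t2] := truncn_itv k0.
exists kappa, (Num.truncn kappa); split => //.
- by rewrite truncn_gt0.
- by rewrite t1.
- by rewrite -powR_mulrn// /kappa -powRrM mulVf ?powRr1// pnatr_eq0.
- rewrite -powR_mulrn// /kappa -powRrM; congr (_ `^ _).
  rewrite natrM -subn1 natrB ?(leq_trans _ n2)// -(natr1 n).
  by field; rewrite natr1 pnatr_eq0.
Qed.

(** * Images of hypersurfaces under shears *)

Section ShearedHypersurface.
Variables (R : realType) (n : nat) (i0 : 'I_n) (h : 'rV[R]_n -> R) (S : set 'rV[R]_n).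
Hypothesis C2h : C2 h.
Hypothesis h_shear : forall x s, h (x + s *: evec R i0) = h x.

Let Phi (y : 'rV[R]_n) := y + h y *: evec R i0.
Let Psi (y : 'rV[R]_n) := y + - h y *: evec R i0.

Lemma C1N (f : 'rV[R]_n -> R) : C1 f -> C1 (fun x => - f x).
Proof.
move=> Cf; apply: (@C1_intro _ _ _ _ (fun i x => - partial i f x)).
  by move=> i x; have := C1_is_derive i x Cf => H; apply: is_deriveN.
by move=> i; apply: continuous_opp; exact: (Cf i).2.
Qed.

Lemma C2N (f : 'rV[R]_n -> R) : C2 f -> C2 (fun x => - f x).
Proof.
move=> [Cf Cdf]; split; first exact: C1N.
move=> i; rewrite (_ : partial i _ = fun x => - partial i f x); first exact: C1N (Cdf i).
by apply: partialE => x; have := C1_is_derive i x Cf => H; apply: is_deriveN.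
Qed.

Lemma shearK : cancel Phi Psi.
Proof. by move=> x; rewrite /Psi /Phi h_shear scaleNr addrK. Qed.

Lemma shearVK : cancel Psi Phi.
Proof. by move=> x; rewrite /Psi /Phi h_shear scaleNr subrK. Qed.

Lemma image_shearE y : (Phi @` S) y <-> S (Psi y).
Proof.
split=> [[x Sx <-]|Sy]; first by rewrite shearK.
by exists (Psi y) => //; rewrite shearVK.
Qed.

Lemma partial_shear_invariant y : partial i0 (fun x => - h x) y = 0.
Proof.
suff H : forall x, is_derive x (evec R i0) (fun x => - h x) 0 by rewrite (partialE H).
move=> x; apply/is_derive_at0.
rewrite (_ : (fun t : R => _) = cst (- h x)); first exact: is_derive_cst.
by apply/funext => t; rewrite addrC h_shear.
Qed.

(** A local equation [F] of [S] pulls back along the explicit inverse [Psi] to a local equation of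
    the image. *)
Lemma C2_hypersurface_shear : C2_hypersurface S -> C2_hypersurface (Phi @` S).
Proof.
move=> HS q /image_shearE Sq; have [U [F [oU Uq C2F gradF US]]] := HS _ Sq.
have C2g := C2N C2h.
have CPsi : continuous Psi by apply: continuous_shear; exact: C1_continuous C2g.1.
exists (Psi @^-1` U), (fun y => F (Psi y)); split.
- by apply: open_comp => // x _; exact: CPsi.
- exact: Uq.
- exact (C2_comp_shear i0 C2F C2g).
- move=> x Ux /image_shearE Sx; have [i iP] := gradF _ Ux Sx.
  have E k := congr1 (fun f => f x) (partial_comp_shear i0 k C2F.1 C2g.1).
  (* Where the [i0] partial of [F] vanishes, the chain rule leaves the partial in direction [i];
     elsewhere [i0] itself works, since [h] is constant along it. *)
  have [D0|D0] := eqVneq (partial i0 F (Psi x)) 0.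
    by exists i; rewrite [X in X != 0]E -/(Psi x) D0 mulr0 addr0.
  by exists i0; rewrite [X in X != 0]E partial_shear_invariant mul0r addr0.
apply/seteqP; split => y /= [Uy].
  move=> /image_shearE Sy; split => //.
  by have : (U `&` S) (Psi y) by []; rewrite US => -[].
move=> Fy; split => //; apply/image_shearE.
by have : (U `&` F @^-1` [set 0]) (Psi y) by []; rewrite -US => -[].
Qed.

Lemma C2_close_shear (eps b : R) : b < eps ->
  (forall x, `|h x| <= b) -> (forall i x, `|partial i h x| <= b) ->
  (forall i j x, `|partial j (partial i h) x| <= b) ->
  C2_close eps S (Phi @` S).
Proof.
move=> beps h0 h1 h2.
have nrm (a : R) : `|a| <= b -> `|a *: evec R i0| < eps.
  move=> ab; apply: le_lt_trans beps; apply: le_trans ab; rewrite normrZ.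
  by rewrite -[leRHS]mulr1 ler_wpM2l// evec_norm_le.
exists Phi, Psi; split.
  split; [exact: C2_shear|exact: C2_shear (C2N C2h)|exact: shearK|exact: shearVK].
have [C1h Cdh] := C2h.
have E i : partial i Phi = fun x => evec R i + partial i h x *: evec R i0.
  exact: partial_shear.
split=> //.
- by move=> x; rewrite /Phi addrAC subrr add0r nrm.
- by move=> x i; rewrite E addrAC subrr add0r nrm.
move=> x i j; rewrite E (partial_affine j (evec R i) (evec R i0) (Cdh i)).
exact: nrm.
Qed.
End ShearedHypersurface.

(** * Lattice points on the perturbed surface *)

(** Among the numerical hypotheses, [4 * M * N <= r * rho] fits the cubes into the ball,
    [4 / eps <= rho] makes the lift small, and the last one says that a gap [1 / (rho * D * M^d)] is
    within reach of a bump of height [eps / 120 * (M / rho)^2]. *)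
Lemma perturbed_points (R : realType) (d : nat) (S : set 'rV[R]_d.+1) (p : 'rV[R]_d.+1)
    (i0 : 'I_d.+1) (r eps eta rho : R) (M N D : nat) :
  C2_hypersurface S ->
  (forall x : 'rV[R]_d.+1, (forall i, i != i0 -> `|x 0 i - p 0 i| <= r) ->
     exists s : R, S (x + s *: evec R i0)) ->
  (forall x y : R, `|x| <= r -> `|y| <= r ->
     2^-1 * `|x - y| <= `|sin x - sin y| <= `|x - y|) ->
  0 < eps -> 0 < eta <= 1 -> d.+1%:R * eta <= eps / 4 -> 4 / eps <= rho ->
  (0 < M)%N -> (0 < N)%N -> M%:R <= rho -> 4 * M%:R * N%:R <= r * rho ->
  2 * (3 + 12 / eta) <= D%:R -> rho <= eps / 120 * (D%:R * M%:R ^+ d.+2) ->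
  exists S' : set 'rV[R]_d.+1,
    [/\ C2_hypersurface S', C2_close eps S S' &
      exists pts : seq 'rV[R]_d.+1,
        [/\ uniq pts, (forall x, x \in pts -> S' x /\ in_scaled_lattice rho x) &
            (N ^ d <= 2 * D * size pts)%N]].
Proof.
move=> HS sec sinr eps0 eta01 neta rho_eps M0 N0 Mrho MNr DC rhoD.
have /andP[eta0 eta1] := eta01.
have rho0 : 0 < rho by apply: lt_le_trans Mrho; rewrite ltr0n.
have M0R : 0 < M%:R :> R by rewrite ltr0n.
pose J := {ffun 'I_d -> 'I_N}; pose U := {ffun 'I_d -> 'I_M}.
pose o k : int := Num.floor (rho * p 0 (lift i0 k)) + 1.
(* Cubes have side [M] but period [4 * M]: columns from different cubes are more than [2 * M] apart
   in some coordinate, so bumps of radius [M / rho] around them are disjoint. *)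
pose m (j : J) (u : U) k : int := o k + (4 * M * j k + u k)%N%:Z.
pose X (j : J) (u : U) k : R := (m j u k)%:~R / rho.
have mE j u k : (m j u k)%:~R = (o k)%:~R + (4 * M%:R * (j k)%:R + (u k)%:R) :> R.
  by rewrite /m intrD; congr (_ + _); rewrite -pmulrn natrD !natrM.
have Xr j u k : `|X j u k - p 0 (lift i0 k)| <= r.
  have /andP[f1 f2] := floor_itv (rho * p 0 (lift i0 k)).
  have E : X j u k - p 0 (lift i0 k) = (((o k)%:~R - rho * p 0 (lift i0 k)) +
      (4 * M%:R * (j k)%:R + (u k)%:R)) / rho.
    by rewrite /X mE; field; rewrite gt_eqF.
  have o1 : 0 <= (o k)%:~R - rho * p 0 (lift i0 k) <= 1.
    rewrite /o in f1 f2 *; rewrite intrD in f2 *; apply/andP; split; lra.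
  (* The [- 1] leaves room for the rounding of [o k], which is at most 1. *)
  have ju : 0 <= (4 : R) * M%:R * (j k)%:R + (u k)%:R <= 4 * M%:R * N%:R - 1.
    rewrite addr_ge0 ?mulr_ge0//= lerBrDr -natrM -natrM -natrD natr1 -natrM ler_nat.
    have hu := ltn_ord (u k); have hj := ltn_ord (j k).
    have H : (4 * M * (j k).+1 <= 4 * M * N)%N by rewrite leq_mul2l hj orbT.
    apply: leq_trans H.
    by rewrite mulnS addnC -addSn leq_add2r (leq_trans hu)// leq_pmull.
  move: o1 ju => /andP[le1 le2] /andP[le3 le4].
  rewrite E ger0_norm; last by rewrite divr_ge0 ?(ltW rho0)// addr_ge0.
  rewrite ler_pdivrMr//; lra.
pose col (j : J) (u : U) : 'rV[R]_d.+1 :=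
  \row_i (if unlift i0 i is Some k then X j u k else 0).
have colE j u k : col j u 0 (lift i0 k) = X j u k by rewrite mxE liftK.
have liftN i : i != i0 -> exists k, i = lift i0 k.
  by have [k -> _|->] := unliftP i0 i; [exists k|rewrite eqxx].
have /choice[y yP] (ju : J * U) : exists s, S (col ju.1 ju.2 + s *: evec R i0).
  by apply: sec => i /liftN[k ->]; rewrite colE.
(* Heights are measured in units of [1 / rho], so that lattice heights are integers. *)
pose phi j u := rho * y (j, u).
pose g j u k := rho * sin (X j u k - p 0 (lift i0 k)).
have gP j (u u' : U) k : u k != u' k -> 2^-1 <= `|g j u k - g j u' k| <= M%:R.
  move=> uu'; rewrite /g -mulrBr normrM (gtr0_norm rho0).
  have /andP[] := sinr _ _ (Xr j u k) (Xr j u' k).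
  have -> : X j u k - p 0 (lift i0 k) - (X j u' k - p 0 (lift i0 k)) =
      ((u k)%:R - (u' k)%:R) / rho.
    by rewrite /X !mE; field; rewrite gt_eqF.
  rewrite normrM normfV (gtr0_norm rho0) mulrA ler_pdivrMr// ler_pdivlMr// => s1 s2.
  have d1 : 1 <= `|(u k)%:R - (u' k)%:R| :> R.
    have [lt|lt|/val_inj e] := ltngtP (u k) (u' k).
    - by rewrite distrC ger0_norm ?subr_ge0 ?ler_nat 1?ltnW// lerBrDr addrC natr1 ler_nat.
    - by rewrite ger0_norm ?subr_ge0 ?ler_nat 1?ltnW// lerBrDr addrC natr1 ler_nat.
    - by rewrite e eqxx in uu'.
  have d2 : `|(u k)%:R - (u' k)%:R| <= M%:R :> R.
    have h1 : (u k)%:R <= M%:R :> R by rewrite ler_nat ltnW.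
    have h2 : (u' k)%:R <= M%:R :> R by rewrite ler_nat ltnW.
    have h3 : 0 <= (u k)%:R :> R by [].
    have h4 : 0 <= (u' k)%:R :> R by [].
    by rewrite ler_norml; apply/andP; split; lra.
  by rewrite mulrC; apply/andP; split; lra.
have [theta [tau [G [u [thetaP tauP cardG hit]]]]] :=
  @many_hits R d M N D eta phi g eta01 M0 N0 DC gP.
pose A : R := (D * M ^ d)%:R.
pose W (j : J) (z : int) := phi j (u j) + \sum_k theta k * g j (u j) k - tau - z%:~R.
have /choice[z zP] (j : J) : exists z : int, j \in G -> 0 <= W j z < A^-1.
  have [jG|_] := boolP (j \in G); last by exists 0.
  by have [z ?] := hit j jG; exists z.
(* The bump removes exactly the excess [W] of the tilted and lifted surface over the lattice height
   [z j]; cubes outside [G] receive none. *)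
pose a (j : J) : R := if j \in G then - (W j (z j)) / rho else 0.
pose c (j : J) := col j (u j).
pose th (i : 'I_d.+1) : R := if unlift i0 i is Some k then theta k else 0.
pose t : R := - tau / rho.
pose delta : R := M%:R / rho.
have delta01 : 0 < delta <= 1 by rewrite divr_gt0//= ler_pdivrMr// mul1r.
have th_le i : `|th i| <= eta.
  by rewrite /th; case: unlift => [k|]; rewrite ?thetaP// normr0 ltW.
(* Bumps of size [eps / 120] cost [30 * (eps / 120) = eps / 4]; lift and tilts cost at most
   [eps / 4] each, which keeps the total below [eps]. *)
have eps120 : 0 <= eps / 120 by rewrite divr_ge0// ltW.
have D0 : 0 < D%:R :> R.
  by apply: lt_le_trans DC; rewrite mulr_gt0// addr_gt0// divr_gt0.
have A0 : 0 < A by rewrite /A natrM mulr_gt0// natrX exprn_gt0.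
have a_le j : `|a j| <= eps / 120 * delta ^+ 2.
  rewrite /a; case: ifP => [jG|_]; last first.
    by rewrite normr0 mulr_ge0// exprn_ge0// ltW//; case/andP: delta01.
  have /andP[w1 w2] := zP j jG.
  rewrite normrM normrN normfV (gtr0_norm rho0) ger0_norm// ler_pdivrMr//.
  apply: (le_trans (ltW w2)); rewrite -[leLHS]mul1r ler_pdivrMr//.
  have -> : eps / 120 * delta ^+ 2 * rho * A = (eps / 120 * (D%:R * M%:R ^+ d.+2)) / rho.
    have -> : M%:R ^+ d.+2 = M%:R ^+ 2 * M%:R ^+ d :> R by rewrite -exprD.
    by rewrite /delta /A natrM natrX; set E := M%:R ^+ d; field; rewrite gt_eqF.
  by rewrite ler_pdivlMr// mul1r.
have sep j j' : j != j' -> exists2 i, i != i0 & 2 * delta <= `|c j 0 i - c j' 0 i|.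
  move=> jj'; have [k kP] : exists k, j k != j' k.
    apply/existsP; apply: contraNT jj'; rewrite negb_exists => /forallP H.
    by apply/eqP/ffunP => k; apply/eqP; rewrite -[_ == _]negbK.
  exists (lift i0 k); first by rewrite eq_sym neq_lift.
  rewrite /c !colE /X -mulrBl normrM normfV (gtr0_norm rho0) /delta mulrA ler_pM2r ?invr_gt0//.
  rewrite !mE.
  have h1 : (u j k)%:R <= M%:R :> R by rewrite ler_nat ltnW.
  have h2 : (u j' k)%:R <= M%:R :> R by rewrite ler_nat ltnW.
  have h3 : 0 <= (u j k)%:R :> R by [].
  have h4 : 0 <= (u j' k)%:R :> R by [].
  have [lt|lt|/val_inj e] := ltngtP (j k) (j' k).
  - rewrite distrC; apply: le_trans (ler_norm _).
    have : M%:R * ((j k)%:R + 1) <= M%:R * (j' k)%:R :> R by rewrite ler_pM2l// natr1 ler_nat.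
    lra.
  - apply: le_trans (ler_norm _).
    have : M%:R * ((j' k)%:R + 1) <= M%:R * (j k)%:R :> R by rewrite ler_pM2l// natr1 ler_nat.
    lra.
  - by rewrite e eqxx in kP.
pose h := perturbation i0 delta t th p a c.
have C2h : C2 h by exact: C2_perturbation.
have h_shear x s : h (x + s *: evec R i0) = h x by exact: perturbation_shear.
pose Phi (y : 'rV[R]_d.+1) := y + h y *: evec R i0.
exists (Phi @` S); split.
- exact: C2_hypersurface_shear.
- pose b := `|t| + d.+1%:R * eta + 30 * (eps / 120).
  apply: (@C2_close_shear _ _ _ _ _ C2h h_shear eps b).
  + have : `|t| <= eps / 4.
      move: tauP => /andP[tau0 tau1].
      rewrite /t normrM normrN normfV (gtr0_norm rho0) (ger0_norm tau0) ler_pdivrMr//.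
      move: rho_eps; rewrite ler_pdivrMr// => h4; lra.
    by rewrite /b; lra.
  + by move=> x; exact: perturbation_norm_le.
  + by move=> i x; exact: partial_perturbation_norm_le.
  + by move=> i k x; exact: partial2_perturbation_norm_le.
pose f (j : J) := c j + ((z j)%:~R / rho) *: evec R i0.
have fE j i : i != i0 -> f j 0 i = c j 0 i.
  by move=> ii; rewrite !mxE eqxx/= (negbTE ii) mulr0 addr0.
exists [seq f j | j <- enum G]; split.
- rewrite map_inj_uniq ?enum_uniq// => j j' ff'; apply/eqP; apply: contrapT => /negP/sep[i ii].
  apply/negP; rewrite -ltNge -!fE// ff' subrr normr0 mulr_gt0//.
  by case/andP: delta01.
- move=> x /mapP[j]; rewrite mem_enum => jG ->; split.
    exists (c j + y (j, u j) *: evec R i0); first exact: (yP (j, u j)).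
    rewrite /Phi h_shear /f -addrA -scalerDl; congr (_ + _ *: _).
    rewrite /h (@perturbation_center _ _ _ _ _ _ _ _ _ _ delta01 sep j)//.
    rewrite big_mkcond (bigD1_ord i0)//= eqxx add0r.
    rewrite (eq_bigr (fun k => theta k * g j (u j) k / rho)); last first.
      by move=> k _; rewrite eq_sym neq_lift /th liftK colE /g; field; rewrite gt_eqF.
    rewrite -mulr_suml /a jG /W /t /phi; field; rewrite gt_eqF//.
  move=> i; have [->|ii] := eqVneq i i0.
    by exists (z j); rewrite !mxE unlift_none eqxx/= eqxx mulr1 add0r.
  have [k ->] := liftN i ii; exists (m j (u j) k).
  by rewrite fE ?colE// eq_sym neq_lift.
by rewrite size_map -cardE.
Qed.

Theorem theorem6p1 (R : realType) (n : nat) (S : set 'rV[R]_n) (eps : R) :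
  (2 <= n)%N -> C2_hypersurface S -> S !=set0 -> 0 < eps ->
  exists (C c : R), 0 < C /\ 0 < c /\
    forall rho : R, C <= rho ->
      exists S' : set 'rV[R]_n,
        [/\ C2_hypersurface S', C2_close eps S S' &
          exists pts : seq 'rV[R]_n,
            [/\ uniq pts,
                (forall x, x \in pts -> S' x /\ in_scaled_lattice rho x) &
                c * rho `^ (n%:R - 2 + 2 / (n%:R + 1)) <= (size pts)%:R]].
Proof.
case: n S => [|d] S // n2 HS [p Sp] eps0.
have [i0 [r0 r0_gt0 sec]] := hypersurface_section HS Sp.
have [r1 r1_gt0 sinr] := sin_bilipschitz_at0 R.
pose r := Num.min r0 r1.
have r_gt0 : 0 < r by rewrite lt_min r0_gt0.
pose eta := Num.min 1 (eps / (4 * d.+1%:R)).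
have eta0 : 0 < eta by rewrite lt_min ltr01 divr_gt0// mulr_gt0.
have eta1 : eta <= 1 by rewrite ge_min lexx.
have eta_eps : d.+1%:R * eta <= eps / 4.
  rewrite mulrC -ler_pdivlMr//; apply: (@le_trans _ _ (eps / (4 * d.+1%:R))).
    by rewrite ge_min lexx orbT.
  by rewrite invfM mulrA.
(* [C0] is what the collision bound asks of [D]. [C1] pays for rounding: [kappa <= 2 * M] gives
   [rho <= (2 * M)^(d+2)]. *)
pose C0 := 2 * (3 + 12 / eta).
pose C1 := 2 ^+ d.+2 * 120 / eps.
have C0_ge0 : 0 <= C0 by rewrite mulr_ge0// addr_ge0// divr_ge0// ltW.
have C1_ge0 : 0 <= C1 by rewrite divr_ge0 ?(ltW eps0)// mulr_ge0// exprn_ge0.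
pose D := (Num.truncn (C0 + C1)).+1.
have DC : C0 + C1 <= D%:R.
  by have /andP[_ /ltW] := truncn_itv (addr_ge0 C0_ge0 C1_ge0).
have D_gt0 : 0 < D%:R :> R by rewrite ltr0n.
(* The summands of the threshold give [rho >= 1], a small lift, and at least one cube per direction.
   In the density, [r / 16] comes from [N >= r * K / 16] and [2 * D] from the proportion of cubes
   hit. *)
exists (1 + 4 / eps + (8 / r) ^+ 2), ((r / 16) ^+ d / (2 * D%:R)).
have e_ge0 : 0 <= 4 / eps by rewrite divr_ge0// ltW.
have q_ge0 : 0 <= (8 / r) ^+ 2 by rewrite sqr_ge0.
split; first by lra.
split; first by rewrite divr_gt0 ?mulr_gt0// exprn_gt0// divr_gt0.
move=> rho rhoC.
have rho1 : 1 <= rho by lra.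
have rho0 : 0 < rho by lra.
have [kappa [M [M0 k1 /andP[Mk kM] kn ->]]] := scale_exists n2 rho1.
have k0 : 0 < kappa by lra.
have M0R : 0 < M%:R :> R by rewrite ltr0n.
set K := kappa ^+ d.+1.
have K0 : 0 < K by rewrite exprn_gt0.
have MK : M%:R * K <= rho by rewrite -kn exprS ler_pM2r.
(* The threshold carries a square because [K^2], a power of [kappa >= 1] with exponent at least
   [d.+2], dominates [rho]. *)
have K8 : 8 / r <= K.
  rewrite -(@ler_pXn2r _ 2)// ?nnegrE ?(ltW K0) ?divr_ge0 ?(ltW r_gt0)//.
  apply: (@le_trans _ _ rho); first by lra.
  rewrite -kn /K -exprM; apply: ler_weXn2l => //.
  by rewrite muln2 -addnn addSn addnS !ltnS leq_addr.
pose x := r * rho / (8 * M%:R).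
have xK : r * K / 8 <= x.
  rewrite ler_pdivlMr ?mulr_gt0//.
  have -> : r * K / 8 * (8 * M%:R) = r * (M%:R * K) by field.
  by rewrite ler_pM2l.
have x1 : 1 <= x.
  by apply: le_trans xK; rewrite ler_pdivlMr// mul1r mulrC -ler_pdivrMr.
have /andP[N1 N2] := truncn_itv (le_trans ler01 x1).
set N := Num.truncn x in N1 N2.
have N0 : (0 < N)%N by rewrite truncn_gt0.
have Nx : x <= 2 * N%:R.
  have N1R : 1 <= N%:R :> R by rewrite ler1n.
  by move: N2; rewrite -natr1; lra.
have Mrho : M%:R <= rho.
  apply: (le_trans Mk); rewrite -kn -[leLHS]expr1; exact: ler_weXn2l.
have MN : 4 * M%:R * N%:R <= r * rho.
  apply: (@le_trans _ _ (4 * M%:R * x)); first by rewrite ler_pM2l ?mulr_gt0.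
  rewrite /x (_ : 4 * M%:R * _ = r * rho / 2); last by field; rewrite gt_eqF.
  by rewrite ler_pdivrMr// ler_peMr ?ler1n// ltW// mulr_gt0.
have rhoD : rho <= eps / 120 * (D%:R * M%:R ^+ d.+2).
  apply: (@le_trans _ _ ((2 * M%:R) ^+ d.+2)).
    rewrite -kn lerXn2r ?nnegrE ?(ltW k0) ?mulr_ge0//.
    apply: (le_trans (ltW kM)); rewrite -natr1; have : 1 <= M%:R :> R by rewrite ler1n.
    lra.
  rewrite exprMn mulrA ler_pM2r ?exprn_gt0//.
  have -> : 2 ^+ d.+2 = eps / 120 * C1 by rewrite /C1; field; rewrite gt_eqF.
  by rewrite ler_pM2l ?divr_gt0//; lra.
have secr (x0 : 'rV[R]_d.+1) : (forall i, i != i0 -> `|x0 0 i - p 0 i| <= r) ->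
    exists s : R, S (x0 + s *: evec R i0).
  by move=> H; apply: sec => i /H h; apply: (le_trans h); rewrite ge_min lexx.
have sinr' (a b : R) : `|a| <= r -> `|b| <= r ->
    2^-1 * `|a - b| <= `|sin a - sin b| <= `|a - b|.
  by move=> ha hb; apply: sinr; [apply: (le_trans ha)|apply: (le_trans hb)];
    rewrite ge_min lexx orbT.
have eta01 : 0 < eta <= 1 by rewrite eta0.
have rho_eps : 4 / eps <= rho by lra.
have D0 : 2 * (3 + 12 / eta) <= D%:R by rewrite -/C0; lra.
have [S' [HS' close [pts [upts ptsP card]]]] := perturbed_points HS secr sinr' eps0
  eta01 eta_eps rho_eps M0 N0 Mrho MN D0 rhoD.
exists S'; split => //; exists pts; split => //.
move: card; rewrite -(ler_nat R) natrX !natrM => card.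
rewrite mulrAC ler_pdivrMr ?mulr_gt0// [leRHS]mulrC; apply: le_trans card.
rewrite exprM -/K -exprMn lerXn2r ?nnegrE ?mulr_ge0 ?divr_ge0 ?(ltW r_gt0) ?(ltW K0)//.
have -> : r / 16 * K = r * K / 8 / 2 by field.
by rewrite ler_pdivrMr// [leRHS]mulrC (le_trans xK).
Qed.
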